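(* Let $r,s\in C^1[0,\infty)$ and $u\in C[0,\infty)$ be real-valued functions satisfying $$\dot s(t)=-2u(t)r(t),\qquad \dot r(t)=-2u(t)s(t),$$ with $\operatorname{sgn}(u(t))=-\operatorname{sgn}(r(t))$ for all $t>0$, $s(0)>0$ and $r(0)>0$ (so that $r(t),s(t)>0$ for all $t$, and $s^2-r^2$ is constant). Assume $s^2-r^2>0$ and put $C=\sqrt{s^2-r^2}$. Let $k>0$, and for $t>0$ let $$W_t(x)=\frac{(2k)_x}{x!}c(t)^x(1-c(t))^{2k},\qquad x\in\mathbb N,$$ where $c(t)\in(0,1)$ is determined by $\frac{s(t)}{r(t)}=\frac{1+c(t)}{2\sqrt{c(t)}}$, or equivalently $c(t)=e^{-2\operatorname{arccosh}(s(t)/r(t))}$. Define for $t>0$ the operator $U_t:\ell^2(\mathbb N)\to\ell^2(\mathbb N,W_t)$ by $$[U_te_n](x)=M_n(x;2k,c(t)).$$ Then $U_t$ is unitary and $U_t\circ\pi_k(L(t))\circ U_t^*=M(2C(x+k))$.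
   Context: $\mathbb N=\{0,1,2,\dots\}$; $(a)_n=a(a+1)\cdots(a+n-1)$. The Lie algebra considered has basis $H,E,F$ with $[H,E]=2E$, $[H,F]=-2F$, $[E,F]=H$ and $*$-structure $H^*=H$, $E^*=-F$ (i.e. $\mathfrak{su}(1,1)$). The Lax operator is $L(t)=s(t)H+r(t)(E-F)$ (with partner $M(t)=u(t)(E+F)$; the differential equations above are $\dot L=[M,L]$). The positive discrete series representation $\pi_k$, $k>0$, on $\ell^2(\mathbb N)$ with standard orthonormal basis $\{e_n\}_{n\in\mathbb N}$ is given by $\pi_k(H)e_n=2(k+n)e_n$, $\pi_k(E)e_n=\sqrt{(n+1)(2k+n)}\,e_{n+1}$, $\pi_k(F)e_n=-\sqrt{n(2k+n-1)}\,e_{n-1}$, $e_{-1}=0$. Hence $$\pi_k(L(t))e_n=r(t)\sqrt{(n+1)(n+2k)}\,e_{n+1}+s(t)(2k+2n)e_n+r(t)\sqrt{n(n+2k-1)}\,e_{n-1}.$$ These operators are densely defined, with domain $\mathcal D$ the finite linear combinations of the $e_n$; the operator identity in the claim is understood on $U_t(\mathcal D)$. Orthonormal Meixner polynomials ($\beta>0$, $0<c<1$): $$M_n(x;\beta,c)=(-1)^n\sqrt{\frac{(\beta)_n}{n!}c^n}\;{}_2F_1\Big({-n,-x\atop\beta};1-\frac1c\Big).$$ $\ell^2(X,W)$ has inner product $\sum_{x\in X}f(x)\overline{g(x)}W(x)$. $M(f)$ denotes multiplication: $[M(f)g](x)=f(x)g(x)$. *)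

(* Defs.v *)
From HB Require Import structures.
From mathcomp Require Import all_boot all_order all_algebra.
From mathcomp Require Import complex ring.
From mathcomp Require Import all_classical all_reals all_analysis.

Set Implicit Arguments.
Unset Strict Implicit.
Unset Printing Implicit Defensive.

Import Order.TTheory GRing.Theory Num.Theory.
Import numFieldNormedType.Exports.

Local Open Scope classical_set_scope.
Local Open Scope complex_scope.
Local Open Scope ring_scope.

Section HalfLine.
Context {R : realType}.
Implicit Types f g : R -> R.

Definition continuous_nng f := {within [set t : R | 0 <= t], continuous f}.

(* One-sided at t = 0: the difference quotient only uses points x >= 0. *)
Definition deriv_nng f g := forall t : R, 0 <= t ->
  (f x - f t) / (x - t) @[x --> within [set x | 0 <= x /\ x != t] (nbhs t)]
    --> g t.

Definition C1_nng f := exists2 g, deriv_nng f g & continuous_nng g.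

End HalfLine.

Section SpecialFunctions.
Context {R : realType}.

Definition arccosh (y : R) : R := ln (y + Num.sqrt (y ^+ 2 - 1)).

Definition pochhammer (a : R) (n : nat) : R := \prod_(i < n) (a + i%:R).

Definition hyp2F1 (a b c z : R) : R :=
  limn (series (fun j : nat =>
    pochhammer a j * pochhammer b j / (pochhammer c j * (j`!)%:R) * z ^+ j)).

Definition meixner (n : nat) (x beta c : R) : R :=
  (-1) ^+ n * Num.sqrt (pochhammer beta n / (n`!)%:R * c ^+ n)
  * hyp2F1 (- n%:R) (- x) beta (1 - c^-1).

Definition meixner_weight (k c : R) (x : nat) : R :=
  pochhammer (2 * k) x / (x`!)%:R * c ^+ x * (1 - c) `^ (2 * k).

End SpecialFunctions.

Section WeightedL2.
Context {R : realType}.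
Local Notation C := R[i].
Implicit Types W : nat -> R.

(* [summable] is absolute summability, so that the set below is a subspace for
   every real W; for W >= 0 the absolute value plays no role. *)
Definition l2_pred W : {pred nat -> C} :=
  mem [set f : nat -> C |
    summable [set: nat] (fun x => (Normc.normc (f x) ^+ 2 * W x)%:E)].

Lemma summable_leZ (K : R) (u v : nat -> R) : 0 <= K ->
  (forall x, `|v x| <= K * `|u x|) ->
  summable [set: nat] (EFin \o u) -> summable [set: nat] (EFin \o v).
Proof.
move=> K0 uv; rewrite /summable => su.
have : (K%:E * (\esum_(x in [set: nat]) `|(EFin \o u) x|) < +oo)%E.
  by rewrite lte_mul_pinfty// lee_fin.
apply: le_lt_trans.
rewrite -nneseries_esumT// -[X in (K%:E * X)%E]nneseries_esumT//.
rewrite -nneseriesZl//; apply: lee_nneseries => // x * /=.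
by rewrite lee_fin.
Qed.

Lemma l2_submod W : submod_closed (l2_pred W).
Proof.
have sqD (z w : C) : Normc.normc (z + w) ^+ 2 <=
    2 * Normc.normc z ^+ 2 + 2 * Normc.normc w ^+ 2.
  case: z w => [a b] [a' b'] /=.
  rewrite !sqr_sqrtr ?addr_ge0 ?sqr_ge0// -subr_ge0.
  have -> : 2 * (a ^+ 2 + b ^+ 2) + 2 * (a' ^+ 2 + b' ^+ 2) -
     ((a + a') ^+ 2 + (b + b') ^+ 2) = (a - a') ^+ 2 + (b - b') ^+ 2 by ring.
  by rewrite addr_ge0 ?sqr_ge0.
split=> [|a f g]; rewrite !inE.
  apply: (@summable_leZ 0 (cst 0)) => // [x|]; last first.
    by rewrite /summable esum1// => x _ /=; rewrite normr0.
  by rewrite [X in Normc.normc X](_ : _ = 0)// Normc.normc0 expr0n mul0r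
    normr0 mul0r.
move=> sf sg.
pose u x := Normc.normc (f x) ^+ 2 * W x.
pose v x := Normc.normc (g x) ^+ 2 * W x.
have su : summable [set: nat] (EFin \o (fun x => `|u x|)).
  by apply: summable_leZ sf => // x; rewrite normr_id mul1r.
have sv : summable [set: nat] (EFin \o (fun x => `|v x|)).
  by apply: summable_leZ sg => // x; rewrite normr_id mul1r.
pose K := 2 * Normc.normc a ^+ 2 + 2.
have K0 : 0 <= K by rewrite addr_ge0// mulr_ge0// sqr_ge0.
apply: (@summable_leZ K (fun x => `|u x| + `|v x|)) => // [x|]; last first.
  exact: summableD su sv.
rewrite [X in K * X]ger0_norm ?addr_ge0// /u /v.
rewrite !(normrM (_ ^+ 2)) -mulrDl mulrA ler_wpM2r// !(ger0_norm (sqr_ge0 _)).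
apply: le_trans (sqD _ _) _.
rewrite Normc.normcM exprMn.
have A0 := sqr_ge0 (Normc.normc a); have B0 := sqr_ge0 (Normc.normc (f x)).
have D0 := sqr_ge0 (Normc.normc (g x)).
rewrite /K -subr_ge0; move: A0 B0 D0.
move: (Normc.normc a ^+ 2) (Normc.normc (f x) ^+ 2) (Normc.normc (g x) ^+ 2).
move=> A B D A0 B0 D0.
have -> : (2 * A + 2) * (B + D) - (2 * (A * B) + 2 * D) = 2 * (A * D) + 2 * B.
  by ring.
by rewrite addr_ge0// mulr_ge0// mulr_ge0.
Qed.

HB.instance Definition _ W := GRing.isSubmodClosed.Build _ _ (l2_pred W)
  (l2_submod W).

Record l2 W := L2 { l2_fun :> nat -> C; l2P : l2_fun \in l2_pred W }.

HB.instance Definition _ W := [isSub for @l2_fun W].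
HB.instance Definition _ W := gen_eqMixin (l2 W).
HB.instance Definition _ W := gen_choiceMixin (l2 W).
HB.instance Definition _ W := [SubChoice_isSubLmodule of l2 W by <:].

Definition inner W (f g : l2 W) : C :=
  limn (series (fun x : nat => f x * (g x)^* * (W x)%:C) : nat -> C^o).

Definition l2norm W (f : l2 W) : R := Num.sqrt (complex.Re (inner f f)).

Definition bounded_op W1 W2 (U : l2 W1 -> l2 W2) :=
  exists K : R, forall f, l2norm (U f) <= K * l2norm f.

Definition is_adjoint W1 W2 (U : l2 W1 -> l2 W2) (V : l2 W2 -> l2 W1) :=
  forall f g, inner (U f) g = inner f (V g).

Definition unitary_op W1 W2 (U : l2 W1 -> l2 W2) (Ustar : l2 W2 -> l2 W1) :=
  [/\ is_adjoint U Ustar, cancel U Ustar & cancel Ustar U].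

Definition mulop (f g : nat -> C) : nat -> C := fun x => f x * g x.

End WeightedL2.

Section DiscreteSeries.
Context {R : realType}.
Local Notation C := R[i].
Local Notation l2N := (l2 (fun=> 1 : R)).

Definition delta (n : nat) : nat -> C := fun x => (x == n)%:R.

Lemma delta_l2 n : delta n \in l2_pred (fun=> 1 : R).
Proof.
rewrite inE /= /summable -nneseries_esumT//.
rewrite (nneseries_split 0 n.+1)//= add0n.
rewrite [X in (_ + X)%E]eseries0 ?adde0 => [|x nx _]; last first.
  by rewrite /delta gtn_eqF// Normc.normc0 expr0n mul0r normr0.
by rewrite sumEFin ltry.
Qed.

Definition basis_e (n : nat) : l2N := L2 (delta_l2 n).

(* Finite linear combinations of the basis. *)
Definition domD : set l2N := [set f | finite_set [set n | f n != 0]].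

(* sl(2,C) in its defining representation, carrying the basis H, E, F. *)
Definition sl2H : 'M[C]_2 := delta_mx 0 0 - delta_mx 1 1.
Definition sl2E : 'M[C]_2 := delta_mx 0 1.
Definition sl2F : 'M[C]_2 := delta_mx 1 0.

Lemma sl2_HE : sl2H *m sl2E - sl2E *m sl2H = 2 *: sl2E.
Proof.
by apply/matrixP => i j; rewrite !(mxE, big_ord_recl, big_ord0) /=;
  case: i j => [[|[|//]] ?] [[|[|//]] ?]; rewrite /=; ring.
Qed.

Lemma sl2_HF : sl2H *m sl2F - sl2F *m sl2H = - 2 *: sl2F.
Proof.
by apply/matrixP => i j; rewrite !(mxE, big_ord_recl, big_ord0) /=;
  case: i j => [[|[|//]] ?] [[|[|//]] ?]; rewrite /=; ring.
Qed.

Lemma sl2_EF : sl2E *m sl2F - sl2F *m sl2E = sl2H.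
Proof.
by apply/matrixP => i j; rewrite !(mxE, big_ord_recl, big_ord0) /=;
  case: i j => [[|[|//]] ?] [[|[|//]] ?]; rewrite /=; ring.
Qed.

Definition piH (k : R) (n : nat) : l2N := (2 * (k + n%:R))%:C *: basis_e n.
Definition piE (k : R) (n : nat) : l2N :=
  (Num.sqrt ((n%:R + 1) * (2 * k + n%:R)))%:C *: basis_e n.+1.
Definition piF (k : R) (n : nat) : l2N :=
  - (Num.sqrt (n%:R * (2 * k + n%:R - 1)))%:C *:
    (if n is m.+1 then basis_e m else 0).

(* pi_k X, with domain domD, is the linear extension of its values on the
   basis: the sum is over the (finite) support of its summand.  The coordinates of a
   traceless X in the basis H, E, F are X 0 0, X 0 1 and X 1 0. *)
Definition pi_k (k : R) (X : 'M[C]_2) (f : l2N) : l2N :=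
  \sum_(n \in [set: nat])
    f n *: (X 0 0 *: piH k n + X 0 1 *: piE k n + X 1 0 *: piF k n).

Definition Lax (s r : R -> R) (t : R) : 'M[C]_2 :=
  (s t)%:C *: sl2H + (r t)%:C *: (sl2E - sl2F).

(* U_t is given on the orthonormal basis only; as an operator on the whole of
   l^2(N) it is the bounded linear map with these values. *)
Definition is_meixner_op (k c : R)
    (U : {linear l2N -> l2 (meixner_weight k c)}) :=
  bounded_op U /\
  forall n x : nat, U (basis_e n) x = (meixner n x%:R (2 * k) c)%:C.

End DiscreteSeries.

(* Main.v *)
(* Up to normalization the Meixner polynomials are the numbers
   F(n,x) = 2F1(-n,-x;b;1-1/c) with b = 2k, which are symmetric in n and x.
   Their three-term recurrence in n says that multiplication by x acts on the
   first index as a Jacobi operator, so the Gram matrix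
   S(n,m) = sum_x w(x) F(n,x) F(m,x) is transformed in the same way by this
   operator in n and in m; hence S is determined by its row S(0,m).  For m > 0
   this row vanishes, because the recurrence in x makes the partial sums of
   w(x) F(m,x) telescope, and S(0,0) is a binomial series.  By the symmetry of F
   the orthonormality of the rows is also that of the columns, i.e. the
   completeness of the polynomials, and U_t is unitary.  The choice of c turns
   the recurrence into the eigenvalue equation of the Lax operator.  For the
   flow: s never vanishes since s^2 > r^2, and r^2 is nondecreasing since
   u r <= 0. *)
From HB Require Import structures.
Require Import Defs.
From mathcomp Require Import all_boot all_order all_algebra.
From mathcomp Require Import complex ring lra.
From mathcomp Require Import all_classical all_reals all_analysis.

Set Implicit Arguments.
Unset Strict Implicit.
Unset Printing Implicit Defensive.

Import Order.TTheory GRing.Theory Num.Theory.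
Import numFieldNormedType.Exports.

Local Open Scope classical_set_scope.
Local Open Scope complex_scope.
Local Open Scope ring_scope.

(** * Weighted l2 spaces *)

Section ComplexLimits.
Context {R : realType}.
Local Notation C := R[i].

Lemma normc_leReIm (z : C) :
  `|z| <= (`|complex.Re z| + `|complex.Im z|)%:C.
Proof.
case: z => a b; rewrite normc_def lecR /=.
rewrite -[leRHS]ger0_norm ?addr_ge0// -sqrtr_sqr ler_sqrt ?sqr_ge0//.
rewrite sqrrD !real_normK ?num_real//.
by rewrite addrAC lerDl mulrn_wge0// mulr_ge0.
Qed.

Lemma cvg_complex (T : Type) (F : set_system T) {FF : Filter F}
    (z : T -> C) (l : C) :
  complex.Re (z x) @[x --> F] --> complex.Re l ->
  complex.Im (z x) @[x --> F] --> complex.Im l ->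
  (z x : C^o) @[x --> F] --> (l : C^o).
Proof.
move=> /cvgrPdist_le re /cvgrPdist_le im; apply/cvgrPdist_le => e e0.
have [er eE] : exists r, e = r%:C.
  by apply/complex_realP; rewrite realE ltW.
rewrite {}eE ltcR in e0 *.
have e20 : 0 < er / 2 by rewrite divr_gt0.
near=> x; apply: (le_trans (normc_leReIm _)).
rewrite lecR (splitr er) raddfB/= raddfB/=; apply: lerD.
  by near: x; exact: re.
by near: x; exact: im.
Unshelve. all: by end_near. Qed.

Lemma cvg_real_complex (T : Type) (F : set_system T) {FF : Filter F}
    (a : T -> R) (l : R) :
  a x @[x --> F] --> l -> ((a x)%:C : C^o) @[x --> F] --> (l%:C : C^o).
Proof. by move=> al; apply: cvg_complex => //=; exact: cvg_cst. Qed.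

Lemma cvg_conj (T : Type) (F : set_system T) {FF : Filter F}
    (z : T -> C) (l : C) :
  (z x : C^o) @[x --> F] --> (l : C^o) ->
  ((z x)^*%R : C^o) @[x --> F] --> (l^*%R : C^o).
Proof.
move=> /cvgrPdist_le zl; apply/cvgrPdist_le => e /zl.
by apply: filterS => x; rewrite -rmorphB norm_conjC.
Qed.

Lemma conj_real_complex (a : R) : (a%:C)^*%R = a%:C :> C.
Proof. by apply/CrealP/complex_realP; exists a. Qed.

Lemma limC (u : nat -> C) (l : C) :
  (u n : C^o) @[n --> \oo] --> (l : C^o) ->
  limn (u : nat -> C^o) = l.
Proof. by move=> ul; apply: cvg_lim ul; exact: norm_hausdorff. Qed.

End ComplexLimits.

(** * Inner product on a weighted sequence space, Bessel's inequality, density of finite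
    sequences *)

Section Inner.
Context {R : realType}.
Local Notation C := R[i].
Variable W : nat -> R.
Hypothesis W_gt0 : forall x, 0 < W x.
Implicit Types f g h : l2 W.

Lemma l2_ext f g : f =1 g -> f = g.
Proof. by move=> /funext fg; exact: val_inj. Qed.

Lemma l2DE f g x : (f + g) x = f x + g x. Proof. by []. Qed.

(** Positivity of [W] removes the absolute values in [summable], so membership becomes convergence
    of an ordinary real series. *)
Lemma l2_predP (u : nat -> C) :
  u \in l2_pred W <-> cvgn (series (fun x => Normc.normc (u x) ^+ 2 * W x)).
Proof.
have u0 x : 0 <= Normc.normc (u x) ^+ 2 * W x.
  by rewrite mulr_ge0 ?sqr_ge0 // ltW.
rewrite inE /=; split=> [su|cu].
  have E : [set: nat] = (fun=> is_true true) by apply/seteqP; split.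
  rewrite E in su; have /= := @summable_cvg R xpredT _ _ su.
  by apply=> i _; rewrite lee_fin.
rewrite /summable -nneseries_esumT//.
rewrite (_ : (fun n => _) = EFin \o
    series (fun x => Normc.normc (u x) ^+ 2 * W x)); last first.
  apply/funext => n /=; rewrite -sumEFin; apply: eq_bigr => i _.
  by rewrite ger0_norm.
by rewrite EFin_lim// ltry.
Qed.

Lemma l2_pred_le (u : nat -> C) (M : R) :
  (forall n, \sum_(0 <= x < n) Normc.normc (u x) ^+ 2 * W x <= M) ->
  u \in l2_pred W.
Proof.
move=> uM; apply/l2_predP; apply: nondecreasing_is_cvgn.
  apply/nondecreasing_seqP => n; rewrite /series /= big_nat_recr//= lerDl.
  by rewrite mulr_ge0 ?sqr_ge0 // ltW.
by exists M => _ [n _ <-]; exact: uM.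
Qed.

Lemma l2_is_cvg f : cvgn (series (fun x => Normc.normc (f x) ^+ 2 * W x)).
Proof. exact/l2_predP/l2P. Qed.

Let term f g x : C := f x * (g x)^*%R * (W x)%:C.

Let term_norm f g x : Normc.normc (term f g x) <=
  Normc.normc (f x) ^+ 2 * W x + Normc.normc (g x) ^+ 2 * W x.
Proof.
have nn (z : C) : Normc.normc (z^*%R) = Normc.normc z.
  by apply: (complexI (R := R)); exact: norm_conjC.
rewrite /term !Normc.normcM nn -mulrDl.
have -> : Normc.normc (W x)%:C = W x.
  by rewrite /= expr0n addr0 sqrtr_sqr gtr0_norm.
have [] : 0 <= Normc.normc (f x) /\ 0 <= Normc.normc (g x).
  by split; [case: (f x)|case: (g x)] => ? ?; exact: sqrtr_ge0.
move: (Normc.normc (f x)) (Normc.normc (g x)) => a b a0 b0.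
apply: ler_wpM2r; first exact/ltW; rewrite -subr_ge0.
have -> : a ^+ 2 + b ^+ 2 - a * b = (a - b) ^+ 2 + a * b by ring.
by rewrite addr_ge0 ?sqr_ge0// mulr_ge0.
Qed.

(** [inner] is a bare [limn], so every algebraic rule for it first needs convergence. By [term_norm]
    the real and imaginary parts are dominated by the sum of the two convergent series of squares,
    hence converge absolutely. *)
Lemma inner_cvg f g :
  (series (fun x => f x * (g x)^* * (W x)%:C) n : C^o)
    @[n --> \oo] --> (inner f g : C^o).
Proof.
have cvg_le (a : nat -> R) : (forall x, `|a x| <= Normc.normc (term f g x)) ->
    cvgn (series a).
  move=> at_; apply: normed_cvg.
  apply: (@series_le_cvg _ _ (fun x => Normc.normc (f x) ^+ 2 * W x +
     Normc.normc (g x) ^+ 2 * W x)) => [x|x|x|].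
  - by rewrite /= normr_ge0.
  - by rewrite addr_ge0// mulr_ge0 ?sqr_ge0// ltW.
  - by rewrite (le_trans (at_ x)).
  - have := is_cvgD (@l2_is_cvg f) (@l2_is_cvg g).
    by rewrite seriesD; exact.
pose re x := complex.Re (term f g x); pose im x := complex.Im (term f g x).
have cre : cvgn (series re).
  apply: cvg_le => x; rewrite -lecR; exact: normc_ge_Re.
have cim : cvgn (series im).
  apply: cvg_le => x; rewrite /im; case: (term f g x) => a b /=.
  by rewrite -sqrtr_sqr ler_sqrt ?addr_ge0 ?sqr_ge0// lerDr sqr_ge0.
have H : (series (term f g) n : C^o) @[n --> \oo] -->
    ((limn (series re) +i* limn (series im)) : C^o).
  apply: cvg_complex => /=.
    apply: cvg_trans cre; apply: near_eq_cvg; near=> n.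
    by rewrite /series /= raddf_sum.
  apply: cvg_trans cim; apply: near_eq_cvg; near=> n.
  by rewrite /series /= raddf_sum.
rewrite /inner; rewrite -[X in series X]/(term f g).
by rewrite (limC H).
Unshelve. all: by end_near. Qed.

Lemma inner_lim f g (l : C) :
  (series (fun x => f x * (g x)^* * (W x)%:C) n : C^o)
    @[n --> \oo] --> (l : C^o) -> inner f g = l.
Proof. exact: limC. Qed.

Lemma innerDl f g h : inner (f + g) h = inner f h + inner g h.
Proof.
apply: inner_lim.
apply: cvg_trans; last exact: (cvgD (@inner_cvg f h) (@inner_cvg g h)).
apply: near_eq_cvg; near=> n.
rewrite fctE /series /= -big_split /=; apply: eq_bigr => i _.
by rewrite !mulrDl.
Unshelve. all: by end_near. Qed.

Lemma innerZl a f g : inner (a *: f) g = a * inner f g.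
Proof.
apply: inner_lim.
apply: cvg_trans; last exact: (@cvgZl_tmp C C^o _ _ _ a _ _ (@inner_cvg f g)).
apply: near_eq_cvg; near=> n.
rewrite /series /= scaler_sumr /=; apply: eq_bigr => i _.
by rewrite /= -!mulrA.
Unshelve. all: by end_near. Qed.

Lemma innerC f g : inner g f = (inner f g)^*%R.
Proof.
apply: inner_lim.
apply: cvg_trans; last exact: (cvg_conj (@inner_cvg f g)).
apply: near_eq_cvg; near=> n.
rewrite /series /= rmorph_sum /=; apply: eq_bigr => i _.
rewrite !rmorphM /= conjCK [(f i)^*%R * _]mulrC; congr (_ * _).
exact: conj_real_complex.
Unshelve. all: by end_near. Qed.

Lemma innerZr a f g : inner f (a *: g) = a^*%R * inner f g.
Proof. by rewrite innerC innerZl rmorphM /= -innerC. Qed.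

Lemma inner0l f : inner 0 f = 0.
Proof. by rewrite -[0](scale0r (0 : l2 W)) innerZl mul0r. Qed.

Lemma innerBl f g h : inner (f - g) h = inner f h - inner g h.
Proof. by rewrite innerDl -scaleN1r innerZl mulN1r. Qed.

Lemma inner_suml I (s : seq I) (P : pred I) (F : I -> l2 W) f :
  inner (\sum_(i <- s | P i) F i) f = \sum_(i <- s | P i) inner (F i) f.
Proof.
apply: (big_morph (fun h => inner h f)) => [g h|].
  exact: innerDl.
exact: inner0l.
Qed.

Lemma inner_sumr I (s : seq I) (P : pred I) (F : I -> l2 W) f :
  inner f (\sum_(i <- s | P i) F i) = \sum_(i <- s | P i) inner f (F i).
Proof.
rewrite innerC inner_suml rmorph_sum; apply: eq_bigr => i _.
by rewrite [RHS]innerC.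
Qed.

Lemma series_innerE f n :
  series (fun x => f x * (f x)^* * (W x)%:C) n =
  (series (fun x => Normc.normc (f x) ^+ 2 * W x) n)%:C.
Proof.
rewrite /series /= raddf_sum /=; apply: eq_bigr => x _.
by rewrite -normCK rmorphM rmorphXn.
Qed.

Lemma inner_normE f :
  inner f f = (limn (series (fun x => Normc.normc (f x) ^+ 2 * W x)))%:C.
Proof.
apply: inner_lim; rewrite (funext (series_innerE f)).
apply: cvg_real_complex. exact: (@l2_is_cvg f).
Qed.

Lemma inner_sqr f : inner f f = (l2norm f ^+ 2)%:C.
Proof.
rewrite /l2norm inner_normE /= sqr_sqrtr//.
apply: limr_ge; first exact: l2_is_cvg.
by apply: nearW => n; apply: sumr_ge0 => i _; rewrite mulr_ge0 ?sqr_ge0// ltW.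
Qed.

Lemma l2norm_ge0 f : 0 <= l2norm f. Proof. exact: sqrtr_ge0. Qed.

Lemma inner_ge0 f : 0 <= inner f f.
Proof. by rewrite inner_sqr ler0c sqr_ge0. Qed.

Lemma inner_partial_le f n :
  \sum_(0 <= x < n) `|f x| ^+ 2 * (W x)%:C <= inner f f.
Proof.
rewrite inner_normE [leLHS](_ : _ =
  (series (fun x => Normc.normc (f x) ^+ 2 * W x) n)%:C); last first.
  by rewrite -series_innerE; apply: eq_bigr => x _; rewrite normCK.
rewrite lecR; apply: nondecreasing_cvgn_le; last exact: l2_is_cvg.
apply/nondecreasing_seqP => k; rewrite /series /= big_nat_recr//= lerDl.
by rewrite mulr_ge0 ?sqr_ge0 // ltW.
Qed.

Lemma inner_eq0 f : inner f f = 0 -> f = 0.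
Proof.
move=> ff0; apply: val_inj; apply/funext => x /=.
have t0 i : 0 <= `|f i| ^+ 2 * (W i)%:C.
  by rewrite mulr_ge0 ?exprn_ge0 ?normr_ge0// ler0c ltW.
have : `|f x| ^+ 2 * (W x)%:C <= 0.
  rewrite -ff0; apply: le_trans (inner_partial_le f x.+1).
  by rewrite big_nat_recr//= lerDr sumr_ge0.
move=> tx; have /eqP : `|f x| ^+ 2 * (W x)%:C == 0 by rewrite eq_le tx t0.
move/eqP; rewrite mulf_eq0 sqrf_eq0 normr_eq0 fmorph_eq0 (gt_eqF (W_gt0 x)).
rewrite orbF.
by move/eqP.
Qed.

(** With [p] the orthogonal projection of [f] on the span of the [h i], both [inner p f] and
    [inner p p] equal the left-hand side, and [inner (f - p) (f - p)] is nonnegative. The squared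
    norms [d i] are arbitrary because the families used later are orthogonal but not all
    normalized. *)
Lemma bessel (h : nat -> l2 W) (d : nat -> R) f n :
  (forall i, 0 < d i) ->
  (forall i j, (i < n)%N -> (j < n)%N ->
    inner (h i) (h j) = (i == j)%:R * (d i)%:C) ->
  \sum_(0 <= i < n) `|inner f (h i)| ^+ 2 * ((d i)^-1)%:C <= inner f f.
Proof.
move=> d0 hh.
pose p := \sum_(0 <= i < n) (((d i)^-1)%:C * inner f (h i)) *: h i.
pose S := \sum_(0 <= i < n) `|inner f (h i)| ^+ 2 * ((d i)^-1)%:C.
have fp : inner p f = S.
  rewrite inner_suml; apply: eq_bigr => i _.
  by rewrite innerZl (innerC f) normCK -mulrA mulrC.
have S0 : 0 <= S.
  apply: sumr_ge0 => i _; rewrite mulr_ge0 ?exprn_ge0 ?normr_ge0// ler0c.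
  by rewrite invr_ge0 ltW.
have pp : inner p p = S.
  rewrite [LHS]inner_suml /S !big_nat; apply: eq_bigr => i /andP[_ iltn].
  rewrite innerZl inner_sumr (bigD1_seq i) ?mem_index_iota ?iota_uniq//=.
  rewrite big_nat_cond big1 ?addr0 => [|j /andP[/andP[_ jltn] /negPf ji]].
    rewrite innerZr hh// eqxx mul1r rmorphM /= conj_real_complex.
    rewrite normCK.
    have di : (d i)%:C != 0 :> C by rewrite fmorph_eq0 (gt_eqF (d0 i)).
    by rewrite fmorphV /=; field.
  by rewrite innerZr hh// eq_sym ji mul0r mulr0.
have := inner_ge0 (f - p).
rewrite innerBl !(innerC (f - p)) !innerBl !rmorphB /= -!innerC fp pp.
rewrite (innerC p f) fp (CrealP _) ?ger0_real//.
by rewrite subrr subr0 subr_ge0.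
Qed.

(** Bessel's inequality for the single vector [g], multiplied by its squared norm. *)
Lemma cauchy_schwarz f g : `|inner f g| <= (l2norm f * l2norm g)%:C.
Proof.
have [g0|gn0] := eqVneq (inner g g) 0.
  rewrite (inner_eq0 g0) innerC inner0l rmorph0 normr0.
  by rewrite ler0c mulr_ge0 ?l2norm_ge0.
have dgt0 : 0 < l2norm g ^+ 2.
  rewrite lt_neqAle sqr_ge0 andbT eq_sym.
  by apply: contraNneq gn0; rewrite inner_sqr => ->.
have := @bessel (fun=> g) (fun=> l2norm g ^+ 2) f 1 (fun=> dgt0).
rewrite big_nat1 => /(_ _)/wrap[|H].
  by move=> [|//] [|//] _ _; rewrite eqxx mul1r inner_sqr.
rewrite -(@ler_pXn2r _ 2)// ?nnegrE ?normr_ge0 ?ler0c ?mulr_ge0 ?l2norm_ge0//.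
move: H; rewrite fmorphV /= ler_pdivrMr; last by rewrite (ltcR 0).
suff -> : (l2norm f * l2norm g)%:C ^+ 2 = inner f f * (l2norm g ^+ 2)%:C by [].
by rewrite inner_sqr -rmorphM -exprMn rmorphXn.
Qed.

Lemma delta_l2_weight n : @delta R n \in l2_pred W.
Proof.
apply: (@l2_pred_le _ (W n)) => N.
apply: (@le_trans _ _ (\sum_(0 <= x < N) (if x == n then W x else 0))).
  apply: ler_sum => x _; rewrite /delta; case: eqP => _.
    by rewrite Normc.normc1 expr1n mul1r.
  by rewrite Normc.normc0 expr0n mul0r.
rewrite -big_mkcond big_nat1_eq; case: ifP => // _; exact/ltW.
Qed.

(** Not normalized: the squared norm is [W n]. *)
Definition l2e (n : nat) : l2 W := L2 (delta_l2_weight n).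

Lemma inner_l2e f n : inner f (l2e n) = f n * (W n)%:C.
Proof.
apply: inner_lim; apply: cvg_near_cst; near=> N.
rewrite /series /= (bigD1_seq n) ?iota_uniq ?mem_index_iota//=; last first.
  by near: N; exact: nbhs_infty_gt.
rewrite big1 ?addr0 => [|x /negPf xn].
  by rewrite /delta eqxx rmorph1 mulr1.
by rewrite /delta xn rmorph0 mulr0 mul0r.
Unshelve. all: by end_near. Qed.

Lemma inner_l2er f n : inner (l2e n) f = (f n)^*%R * (W n)%:C.
Proof. by rewrite innerC inner_l2e rmorphM /= conj_real_complex. Qed.

Lemma l2_sumE I (s : seq I) (P : pred I) (F : I -> l2 W) x :
  (\sum_(i <- s | P i) F i : l2 W) x = \sum_(i <- s | P i) F i x.
Proof. exact: (big_morph (fun h : l2 W => h x)). Qed.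

Definition l2_trunc f N : l2 W := \sum_(0 <= n < N) f n *: l2e n.

Lemma l2_truncE f N x : l2_trunc f N x = if (x < N)%N then f x else 0.
Proof.
rewrite /l2_trunc l2_sumE.
rewrite (eq_bigr (fun i => if i == x then f i else 0)) => [|i _]; last first.
  rewrite [LHS](_ : _ = f i * (x == i)%:R)// eq_sym.
  by case: eqP => _; rewrite ?mulr1 ?mulr0.
by rewrite -big_mkcond big_nat1_eq.
Qed.

(** Truncation is an orthogonal projection, so Pythagoras leaves the tail of the series of [f]. *)
Lemma l2norm_trunc f N : l2norm (f - l2_trunc f N) ^+ 2 =
  l2norm f ^+ 2 - series (fun x => Normc.normc (f x) ^+ 2 * W x) N.
Proof.
apply: (@complexI R); rewrite -inner_sqr rmorphB /= -inner_sqr -series_innerE.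
set S := series _ N.
have fp : inner (l2_trunc f N) f = S.
  rewrite inner_suml; apply: eq_bigr => n _.
  by rewrite innerZl inner_l2er mulrA.
have pp : inner (l2_trunc f N) (l2_trunc f N) = S.
  rewrite [LHS]inner_suml /S /series /= !big_nat; apply: eq_bigr => i /= iN.
  by rewrite innerZl inner_l2er l2_truncE iN mulrA.
have Sr : S^*%R = S by rewrite -pp -innerC.
rewrite innerBl !(innerC (f - _)) !innerBl !rmorphB /= -!innerC fp pp.
by rewrite (innerC (l2_trunc f N) f) fp Sr subrr subr0.
Qed.

(* The truncations [l2_trunc f N] converge to [f] in norm. *)
Lemma bounded_functional_eq0 (L : l2 W -> C) (K : R) :
  (forall f g, L (f - g) = L f - L g) ->
  (forall a f, L (a *: f) = a * L f) ->
  (forall f, `|L f| <= (K * l2norm f)%:C) ->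
  (forall n, L (l2e n) = 0) -> forall f, L f = 0.
Proof.
move=> LB LZ LK L0 f.
have LD g h : L (g + h) = L g + L h.
  have -> : g + h = g - (-1) *: h by rewrite scaleN1r opprK.
  by rewrite LB LZ mulN1r opprK.
have Lz : L 0 = 0 by rewrite -(scale0r (0 : l2 W)) LZ mul0r.
have Lt N : L (l2_trunc f N) = 0.
  rewrite /l2_trunc (big_morph L LD Lz) big1// => i _.
  by rewrite LZ L0 mulr0.
(* [L] kills the truncation, so [L f = L (f - l2_trunc f N)], which is controlled by a tail tending
   to 0. *)
have bnd N : Normc.normc (L f) ^+ 2 <= K ^+ 2 *
    (l2norm f ^+ 2 - series (fun x => Normc.normc (f x) ^+ 2 * W x) N).
  rewrite -l2norm_trunc -exprMn.
  have := LK (f - l2_trunc f N); rewrite LB Lt subr0 lecR => le1.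
  have n0 : 0 <= Normc.normc (L f) by case: (L f) => ? ?; exact: sqrtr_ge0.
  by rewrite ler_pXn2r// nnegrE// (le_trans n0).
have lim0 : K ^+ 2 * (l2norm f ^+ 2 -
    series (fun x => Normc.normc (f x) ^+ 2 * W x) N) @[N --> \oo] --> 0.
  rewrite -(mulr0 (K ^+ 2)); apply: cvgMl_tmp.
  have E : l2norm f ^+ 2 =
      limn (series (fun x => Normc.normc (f x) ^+ 2 * W x)).
    by apply: (@complexI R); rewrite -inner_sqr inner_normE.
  rewrite -(subrr (l2norm f ^+ 2)) {3}E; apply: cvgB; first exact: cvg_cst.
  exact: (@l2_is_cvg f).
have : Normc.normc (L f) ^+ 2 <= 0.
  rewrite -(cvg_lim (@Rhausdorff R) lim0); apply: limr_ge.
    by apply/cvg_ex; eexists; exact: lim0.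
  exact: nearW.
move=> n0; apply: Normc.eq0_normc; apply/eqP; rewrite -sqrf_eq0.
by rewrite eq_le n0 sqr_ge0.
Qed.

End Inner.

(** * Fourier coefficients with respect to an orthogonal family *)

Section Coefficients.
Context {R : realType}.
Local Notation C := R[i].
Variables (W W' : nat -> R).
Hypotheses (W_gt0 : forall x, 0 < W x) (W'_gt0 : forall x, 0 < W' x).
Variable h : nat -> l2 W.
Hypothesis hh : forall i j, inner (h i) (h j) = (i == j)%:R * ((W' i)^-1)%:C.

Let coef_partial (f : l2 W) n :
  \sum_(0 <= i < n) Normc.normc (inner f (h i)) ^+ 2 * W' i <= l2norm f ^+ 2.
Proof.
rewrite -lecR -inner_sqr// rmorph_sum /=.
have d0 i : 0 < (W' i)^-1 by rewrite invr_gt0.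
have := @bessel _ _ W_gt0 h _ f n d0 (fun i j _ _ => hh i j).
apply: le_trans; apply: ler_sum => i _.
by rewrite invrK rmorphM rmorphXn.
Qed.

Fact coef_subproof (f : l2 W) : (fun i => inner f (h i)) \in l2_pred W'.
Proof. exact: (l2_pred_le W'_gt0 (coef_partial f)). Qed.

(** Since [h i] has squared norm [(W' i)^-1], Bessel's inequality puts the coefficients in the space
    with weight [W']. The map serves twice: it gives the adjoint of [U] (with [W' = 1]) and the
    Meixner transform itself. *)
Definition l2coef (f : l2 W) : l2 W' := L2 (coef_subproof f).

Lemma l2coef_linear : linear l2coef.
Proof.
move=> a f g; apply: val_inj; apply/funext => i /=.
by rewrite innerDl// innerZl.
Qed.

HB.instance Definition _ := GRing.isLinear.Build _ _ _ _ l2coef l2coef_linear.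

Lemma l2norm_coef f : l2norm (l2coef f) <= l2norm f.
Proof.
rewrite -(@ler_pXn2r _ 2)// ?nnegrE ?l2norm_ge0// -lecR -inner_sqr//.
rewrite inner_normE// lecR; apply: limr_le; last first.
  by apply: nearW => n; exact: coef_partial.
exact: (@l2_is_cvg _ _ W'_gt0 (l2coef f)).
Qed.

End Coefficients.

(** * A unitarity criterion: orthonormal rows and orthogonal columns *)

Section Unitary.
Context {R : realType}.
Local Notation C := R[i].
Local Notation l2N := (l2 (fun=> 1 : R)).
Variable W : nat -> R.
Hypothesis W_gt0 : forall x, 0 < W x.

Lemma weight1_gt0 (n : nat) : 0 < (fun=> 1 : R) n.
Proof. exact: ltr01. Qed.

Lemma l2e_basis n : l2e weight1_gt0 n = basis_e n.
Proof. exact: val_inj. Qed.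

Lemma inner_basis (f : l2N) n : inner f (basis_e n) = f n.
Proof. by rewrite -l2e_basis inner_l2e mulr1. Qed.

(* [V] is the adjoint, [V g n = inner g (U (basis_e n))].  Orthonormality of
   the [U (basis_e n)] gives [V (U f) = f]; the relations for [psi] say that [V]
   is isometric on the unit vectors of [l2 W], whence [U (V g) = g]. *)
Lemma unitary_of_basis (U : {linear l2N -> l2 W}) (psi : nat -> l2N) :
  bounded_op U ->
  (forall i j, inner (U (basis_e i)) (U (basis_e j)) = (i == j)%:R) ->
  (forall x n, psi x n = (U (basis_e n) x)^*%R) ->
  (forall x y, inner (psi x) (psi y) = (x == y)%:R * ((W x)^-1)%:C) ->
  exists V : l2 W -> l2N, unitary_op U V.
Proof.
move=> [K UK] rows psiE psi_orth.
have rows' i j : inner (U (basis_e i)) (U (basis_e j)) =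
    (i == j)%:R * (1^-1 : R)%:C by rewrite rows invr1 mulr1.
pose V : {linear l2 W -> l2N} := l2coef W_gt0 weight1_gt0 rows'.
have VE g n : V g n = inner g (U (basis_e n)) by [].
have Vle g : l2norm (V g) <= l2norm g by exact: l2norm_coef.
(* For fixed [g] the difference of both sides is a bounded linear functional of [f], so it suffices
   to test it on the basis. *)
have adj : is_adjoint U V.
  move=> f g; apply/eqP; rewrite -subr_eq0; apply/eqP.
  apply: (@bounded_functional_eq0 _ _ weight1_gt0
    (fun f => inner (U f) g - inner f (V g)) (K * l2norm g + l2norm (V g))).
  - move=> f1 f2; rewrite raddfB !innerBl// !opprD !opprK.
    by rewrite -!addrA; congr (_ + _); rewrite addrCA.
  - by move=> a f1; rewrite linearZ !innerZl// mulrBr.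
  - move=> f1; rewrite (le_trans (ler_normB _ _))// mulrDl rmorphD lerD//.
      apply: le_trans (cauchy_schwarz W_gt0 _ _) _; rewrite lecR.
      by rewrite mulrAC ler_wpM2r// l2norm_ge0.
    by rewrite mulrC; exact: (cauchy_schwarz weight1_gt0).
  - move=> n; cbv beta.
    rewrite l2e_basis [inner (basis_e n) _]innerC// inner_basis.
    by rewrite VE -innerC// subrr.
have VUe n : V (U (basis_e n)) = basis_e n.
  by apply: l2_ext => m; rewrite VE rows /= /delta eq_sym.
have VU : cancel U V.
  move=> f; apply: l2_ext => m.
  by rewrite VE adj VUe inner_basis.
have Vdelta x : V (l2e W_gt0 x) = (W x)%:C *: psi x.
  apply: l2_ext => n.
  by rewrite VE inner_l2er mulrC -psiE.
(* The same density argument, now in [l2 W]; on unit vectors it is the orthogonality of the columns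
   [psi]. *)
have isoV g y : inner (V g) (V (l2e W_gt0 y)) = inner g (l2e W_gt0 y).
  apply/eqP; rewrite -subr_eq0; apply/eqP.
  apply: (@bounded_functional_eq0 _ _ W_gt0
    (fun g => inner (V g) (V (l2e W_gt0 y)) - inner g (l2e W_gt0 y))
    (l2norm (V (l2e W_gt0 y)) + l2norm (l2e W_gt0 y))).
  - move=> f1 f2; rewrite raddfB !innerBl// !opprD !opprK.
    by rewrite -!addrA; congr (_ + _); rewrite addrCA.
  - by move=> a f1; rewrite linearZ !innerZl// mulrBr.
  - move=> f1; rewrite (le_trans (ler_normB _ _))// mulrDl rmorphD lerD//.
      apply: le_trans (cauchy_schwarz weight1_gt0 _ _) _; rewrite lecR mulrC.
      by rewrite ler_wpM2l// l2norm_ge0.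
    by rewrite mulrC; exact: (cauchy_schwarz W_gt0).
  - move=> x; rewrite !Vdelta innerZl// innerZr// psi_orth inner_l2e.
    rewrite [l2e W_gt0 x y](_ : _ = (y == x)%:R)// eq_sym.
    case: eqP => [->|_]; last by rewrite !mul0r !mulr0 subrr.
    rewrite !mul1r conj_real_complex -!rmorphM /= mulfV ?mulr1 ?subrr//.
    exact: lt0r_neq0.
exists V; split => // g; apply: l2_ext => y.
(* Pairing [U (V g)] with a unit vector and moving [U] across gives the left side of [isoV], so
   [U (V g)] and [g] agree at [y] after cancelling [W y]. *)
have := adj (V g) (l2e W_gt0 y); rewrite isoV !inner_l2e.
by apply: mulIf; rewrite fmorph_eq0 lt0r_neq0.
Qed.

End Unitary.

(** * Meixner polynomials *)

Section Subexponential.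
Context {R : realType}.
Implicit Types f g : nat -> R.

(* Growth slower than every exponential: the weights [a x * c ^+ x] with
   [a] subexponential and [0 < c < 1] integrate every such function. *)
Definition subexp f := forall rho : R, 1 < rho ->
  exists M, forall n, `|f n| <= M * rho ^+ n.

Lemma subexp_cst (a : R) : subexp (fun=> a).
Proof.
move=> rho rho1; exists `|a| => n.
by rewrite ler_peMr// exprn_ege1// ltW.
Qed.

Lemma subexpD f g : subexp f -> subexp g -> subexp (fun n => f n + g n).
Proof.
move=> sf sg rho rho1; have [M fM] := sf _ rho1; have [N gN] := sg _ rho1.
exists (M + N) => n; rewrite mulrDl (le_trans (ler_normD _ _))//.
exact: lerD.
Qed.

(** Each factor is bounded with the rate [Num.sqrt rho], which still exceeds 1. *)
Lemma subexpM f g : subexp f -> subexp g -> subexp (fun n => f n * g n).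
Proof.
move=> sf sg rho rho1.
have s1 : 1 < Num.sqrt rho by rewrite -sqrtr1 ltr_sqrt// (lt_trans ltr01).
have [M fM] := sf _ s1; have [N gN] := sg _ s1; exists (M * N) => n.
have -> : rho ^+ n = Num.sqrt rho ^+ n * Num.sqrt rho ^+ n.
  by rewrite -exprMn -expr2 sqr_sqrtr// ltW// (lt_trans ltr01).
by rewrite normrM mulrACA ler_pM.
Qed.

Lemma subexp_nat : subexp (fun n => n%:R).
Proof.
(* The constant comes from Bernoulli's inequality [n * (rho - 1) <= rho ^ n]. *)
move=> rho rho1; exists (rho - 1)^-1 => n.
have r0 : 0 < rho - 1 by rewrite subr_gt0.
rewrite normr_nat mulrC ler_pdivlMr//.
elim: n => [|n IH]; first by rewrite mul0r expr0 ler01.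
rewrite -natr1 mulrDl mul1r exprS.
have : 1 <= rho ^+ n by rewrite exprn_ege1// ltW.
move: IH; move: (rho ^+ n) => t; nra.
Qed.

Lemma subexp_is_cvg f (q : R) : subexp f -> `|q| < 1 -> cvgn (pseries f q).
Proof.
move=> sf q1.
(* Chosen so that both [1 < rho] and [rho * |q| < 1], which gives a geometric majorant. *)
pose rho := 2 / (1 + `|q|).
have d0 : 0 < 1 + `|q| by rewrite ltr_wpDr.
have rho1 : 1 < rho by rewrite /rho ltr_pdivlMr// mul1r; lra.
have [M fM] := sf _ rho1.
apply: normed_cvg.
apply: (@series_le_cvg _ _ (geometric M (rho * `|q|))) => [n|n|n|].
- by rewrite /= normr_ge0.
- rewrite /= mulr_ge0//.
    have := le_trans (normr_ge0 _) (fM 0%N); by rewrite expr0 mulr1.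
  by rewrite exprn_ge0// mulr_ge0// ltW// (lt_trans ltr01).
- by rewrite /= normrM normrX exprMn mulrA ler_wpM2r// exprn_ge0.
- apply: is_cvg_geometric_series.
  rewrite ger0_norm ?mulr_ge0// ?(ltW (lt_trans ltr01 _))//.
  by rewrite /rho mulrAC ltr_pdivrMr// mul1r; lra.
Qed.

Lemma subexp_cvg0 f (q : R) : subexp f -> `|q| < 1 ->
  f n * q ^+ n @[n --> \oo] --> 0.
Proof. by move=> sf q1; apply: cvg_series_cvg_0; exact: subexp_is_cvg. Qed.

End Subexponential.

(** * Pochhammer symbols and their growth *)

Section Pochhammer.
Context {R : realType}.
Implicit Types a b : R.

Lemma pochhammer0 a : pochhammer a 0 = 1.
Proof. by rewrite /pochhammer big_ord0. Qed.

Lemma pochhammerS a n : pochhammer a n.+1 = pochhammer a n * (a + n%:R).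
Proof. by rewrite /pochhammer big_ord_recr. Qed.

Lemma pochhammerSl a n : pochhammer a n.+1 = a * pochhammer (a + 1) n.
Proof.
rewrite /pochhammer big_ord_recl addr0; congr (_ * _).
by apply: eq_bigr => i _ /=; rewrite -addrA natrD.
Qed.

Lemma pochhammer_gt0 a n : 0 < a -> 0 < pochhammer a n.
Proof.
by move=> a0; apply: prodr_gt0 => i _; rewrite ltr_wpDr.
Qed.

Lemma pochhammer_fact_rec b n :
  n.+1%:R * (pochhammer b n.+1 / (n.+1`!)%:R) =
  (b + n%:R) * (pochhammer b n / (n`!)%:R).
Proof.
rewrite pochhammerS factS natrM; field.
by rewrite nat1r !pnatr_eq0 -lt0n fact_gt0.
Qed.

Lemma pochhammer_nat_eq0 n j : (n < j)%N -> pochhammer (- n%:R : R) j = 0.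
Proof.
move=> nj; apply/eqP; rewrite prodf_seq_eq0; apply/hasP.
by exists (Ordinal nj); rewrite ?mem_index_enum//= addNr.
Qed.

Lemma le_pochhammer a b n : 0 < a -> a <= b -> pochhammer a n <= pochhammer b n.
Proof.
move=> a0 ab; apply: ler_prod => i _; rewrite addr_ge0 ?(ltW a0)//=.
by rewrite lerD2r.
Qed.

(** For a positive integer [b], induction: raising [b] by 1 multiplies the sequence by a function
    linear in [n]. A general [b] is dominated by the next integer. *)
Lemma subexp_pochhammer b : 0 < b ->
  subexp (fun n => pochhammer b n / (n`!)%:R).
Proof.
move=> b0.
have nat_case m : subexp (fun n => pochhammer (m.+1%:R : R) n / (n`!)%:R).
  elim: m => [|m IH].
    have -> : (fun n => pochhammer (1%:R : R) n / (n`!)%:R) = (fun=> 1).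
      apply/funext => n.
      have -> : pochhammer (1%:R : R) n = (n`!)%:R.
        elim: n => [|n IH]; first by rewrite pochhammer0.
        by rewrite pochhammerS IH factS mulnC natrM nat1r.
      by rewrite mulfV// pnatr_eq0 -lt0n fact_gt0.
    exact: subexp_cst.
  have -> : (fun n => pochhammer (m.+2%:R : R) n / (n`!)%:R) =
    (fun n => pochhammer (m.+1%:R : R) n / (n`!)%:R *
       ((m.+1%:R + n%:R) * (m.+1%:R)^-1)).
    apply/funext => n.
    have -> : pochhammer (m.+2%:R : R) n =
        pochhammer m.+1%:R n * (m.+1%:R + n%:R) / m.+1%:R.
      by rewrite -pochhammerS pochhammerSl natr1 mulrAC mulfV ?mul1r.
    by ring.
  apply: subexpM IH _; apply: subexpM (subexp_cst _).
  exact: subexpD (subexp_cst _) subexp_nat.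
have bB := truncnS_gt b; set B := (Num.truncn b).+1 in bB.
move=> rho rho1; have [M PM] := nat_case (Num.truncn b) _ rho1.
exists M => n; apply: le_trans (PM n).
have B0 : 0 < (Num.truncn b).+1%:R :> R by rewrite ltr0n.
rewrite !ger0_norm ?divr_ge0// ?(ltW (pochhammer_gt0 _ _))//.
by rewrite ler_pM2r ?invr_gt0 ?ltr0n ?fact_gt0// le_pochhammer// ltW.
Qed.

End Pochhammer.

(** * The binomial series *)

Section BinomialSeries.
Context {R : realType}.
Variable b : R.
Hypothesis b0 : 0 < b.

Let a n : R := pochhammer b n / (n`!)%:R.

Let aS n : n.+1%:R * a n.+1 = (b + n%:R) * a n.
Proof. exact: pochhammer_fact_rec. Qed.

(** The series of [n * a n * x ^ n] is evaluated in two ways: as [x] times the derived series and,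
    by the recurrence [aS], as the derived series minus [b] times the original one. *)
Let ODE (x : R) : `|x| < 1 ->
  (1 - x) * limn (pseries (pseries_diffs a) x) = b * limn (pseries a x).
Proof.
move=> x1.
have da : pseries_diffs a = (fun n => (b + n%:R) * a n).
  by apply/funext => n; exact: aS.
have sa : subexp a by exact: subexp_pochhammer.
have sda : subexp (pseries_diffs a).
  rewrite da; apply: subexpM => //.
  exact: subexpD (subexp_cst _) subexp_nat.
have ca := subexp_is_cvg sa x1; have cda := subexp_is_cvg sda x1.
have c1 : series (fun n => n%:R * a n * x ^+ n) @ \oo -->
    x * limn (pseries (pseries_diffs a) x).
  have -> : series (fun n => n%:R * a n * x ^+ n) =
      (fun N => x * series (fun i => i%:R * a i * x ^+ i.-1) N).
    apply/funext => N; rewrite /series /= mulr_sumr; apply: eq_bigr => -[|i] _.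
      by rewrite !mul0r mulr0.
    by rewrite [i.+1.-1]/= exprS; ring.
  by apply: cvgMl_tmp; exact: pseries_diffs_equiv cda.
have c2 : series (fun n => n%:R * a n * x ^+ n) @ \oo -->
    limn (pseries (pseries_diffs a) x) - b * limn (pseries a x).
  have -> : series (fun n => n%:R * a n * x ^+ n) =
      (fun N => pseries (pseries_diffs a) x N - b * pseries a x N).
    apply/funext => N; rewrite /pseries /series /= mulr_sumr -sumrB.
    by apply: eq_bigr => i _; rewrite da; ring.
  by apply: cvgB => //; apply: cvgMl_tmp.
have := cvg_unique (@Rhausdorff R) c1 c2.
by rewrite mulrBl mul1r => ->; rewrite opprB addrC subrK.
Qed.

(** By [ODE] the product [G] of the series and [(1 - x) ^ b] has zero derivative, and [G 0 = 1]. *)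
Lemma binomial_series (c : R) : 0 < c < 1 ->
  limn (pseries (fun n => pochhammer b n / (n`!)%:R) c) * (1 - c) `^ b = 1.
Proof.
move=> /andP[c0 c1].
have sa : subexp a by exact: subexp_pochhammer.
have sbn : subexp (fun n : nat => b + n%:R).
  exact: subexpD (subexp_cst _) subexp_nat.
have da : pseries_diffs a = (fun n => (b + n%:R) * a n).
  by apply/funext => n; exact: aS.
have sda : subexp (pseries_diffs a) by rewrite da; exact: subexpM.
have dda : subexp (pseries_diffs (pseries_diffs a)).
  have -> : pseries_diffs (pseries_diffs a) =
      fun n => (b + n%:R + 1) * ((b + n%:R) * a n).
    by apply/funext => n; rewrite da /pseries_diffs mulrCA aS -natr1; ring.
  apply: subexpM; last exact: subexpM.
  exact: subexpD sbn (subexp_cst _).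
(* A radius strictly between [c] and 1, inside which the series may be differentiated termwise. *)
pose K := (1 + c) / 2.
have K1 : `|K| < 1 by rewrite ger0_norm /K; lra.
have cK : c < `|K| by rewrite ger0_norm /K; lra.
pose G (x : R) := limn (pseries a x) * (1 - x) `^ b.
(* The upper bound is [K]: an open interval around [[0, c]] on which [|x| < K]. *)
have dG (x : R) : - c < x < c + (1 - c) / 2 -> is_derive x 1 G 0.
  move=> /andP[xl xr].
  have xK : `|x| < `|K| by rewrite [ltRHS]ger0_norm ?ltr_norml /K; lra.
  have dS := pseries_snd_diffs (subexp_is_cvg sa K1) (subexp_is_cvg sda K1)
     (subexp_is_cvg dda K1) xK.
  have x0 : 0 < 1 - x by lra.
  have dP : is_derive x 1 ((fun y => y `^ b) \o (fun y => 1 - y))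
      (b * (1 - x) `^ (b - 1) * (-1)).
    have d1 : is_derive x 1 (fun y : R => 1 - y) (-1).
      rewrite -[X in is_derive _ _ _ X]sub0r.
      exact: (is_deriveB (is_derive_cst _ _ _) (is_derive_id _ _)).
    have d2 := is_derive1_powR b x0.
    exact: (@is_derive1_comp R (fun y => y `^ b) (fun y => 1 - y) x _ _ d2 d1).
  have x1 : `|x| < 1 by rewrite (lt_trans xK).
  apply: (is_derive_eq (is_deriveM dS dP)).
  (* Splitting off one factor [1 - x] exposes the left-hand side of [ODE]. *)
  rewrite /= -[(1 - x) `^ b](mulr_powRB1 (ltW x0) b0).
  rewrite /GRing.scale /=.

  have := ODE x1.
  set S := limn (pseries a x).
  set S' := limn (pseries (pseries_diffs a) x) => E.
  rewrite -[RHS](mulr0 ((1 - x) `^ (b - 1))) -(subrr (b * S)) -{1}E.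
  by ring.
have G0 : G 0 = 1.
  rewrite /G subr0 powR1 mulr1; apply: cvg_lim; first exact: Rhausdorff.
  apply: cvg_near_cst; near=> N.
  rewrite /pseries /series /= big_ltn//; last first.
    by near: N; exact: nbhs_infty_gt.
  rewrite big_nat_cond big1 ?addr0 => [|i /andP[/andP[i0 _] _]].
    by rewrite /a pochhammer0 fact0 invr1 !mulr1.
  by rewrite expr0n gtn_eqF// mulr0.
have inc : {in `[0, c], forall x, - c < x < c + (1 - c) / 2}.
  by move=> x; rewrite in_itv /= => /andP[x0 xc]; apply/andP; split; lra.
have [|||d _] := @MVT R G (fun=> 0) 0 c.
- by [].
- move=> x xc; apply: dG; apply: inc.
  exact: subset_itv_oo_cc xc.
- apply: derivable_within_continuous => x xc.
  by have [] := dG _ (inc _ xc).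
by rewrite mul0r => /eqP; rewrite subr_eq0 G0 => /eqP.
Unshelve. all: by end_near. Qed.

End BinomialSeries.

(** * Recurrence, orthogonality and completeness of the Meixner polynomials *)

Section Meixner.
Context {R : realType}.
Variables b c : R.
Hypotheses (b0 : 0 < b) (c01 : 0 < c < 1).

Let c0 : 0 < c. Proof. by case/andP: c01. Qed.
Let c1 : c < 1. Proof. by case/andP: c01. Qed.
Let z : R := 1 - c^-1.

Let cz : c * z = c - 1.
Proof. by rewrite /z mulrBr mulr1 mulfV// gt_eqF. Qed.

Let A (x : R) j := pochhammer (- x) j / (pochhammer b j * (j`!)%:R) * z ^+ j.

(** Partial sums of the hypergeometric series. The degree [a] is real, so the shifts to [a + 1] and
    [a - 1] need no case analysis; [A] collects the factors independent of the degree. *)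
Definition meixner_sum (a x : R) N : R :=
  \sum_(0 <= j < N) pochhammer (- a) j * A x j.

Let AS x j : A x j.+1 * ((b + j%:R) * j.+1%:R) = A x j * (z * (j%:R - x)).
Proof.
rewrite /A !pochhammerS factS natrM exprS.
have bj : b + j%:R != 0 by rewrite gt_eqF// ltr_wpDr.
have pj := lt0r_neq0 (pochhammer_gt0 j b0).
have fj : (j`!)%:R != 0 :> R by rewrite pnatr_eq0 -lt0n fact_gt0.
by field; rewrite bj pj fj nat1r pnatr_eq0.
Qed.

(* The right-hand side is the boundary term of a telescoping sum over [j]; it
   vanishes as soon as [a] is an integer smaller than [N]. *)
Lemma meixner_sum_rec (a x : R) N :
  c * (a + b) * meixner_sum (a + 1) x N.+1
  - (a + (a + b) * c) * meixner_sum a x N.+1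
  + a * meixner_sum (a - 1) x N.+1 - (c - 1) * x * meixner_sum a x N.+1 =
  (c - 1) * (N%:R - x) * A x N * pochhammer (- a) N.
Proof.
elim: N => [|N IH].
  rewrite /meixner_sum !big_nat1 !pochhammer0 /A !pochhammer0 fact0 expr0.
  by field.
have e1 : pochhammer (- (a + 1)) N.+1 = - (a + 1) * pochhammer (- a) N.
  by rewrite pochhammerSl; congr (_ * pochhammer _ _); ring.
(* The factor [a] is kept because [(-a)_(N+1) = -a (1-a)_N]; thus no division by [a] is needed. *)
have e2 : a * pochhammer (- (a - 1)) N.+1 =
    - pochhammer (- a) N * (N%:R - a) * (N.+1%:R - a).
  have := pochhammerSl (- a) N; rewrite pochhammerS => E.
  rewrite pochhammerS (_ : - (a - 1) = - a + 1); last by ring.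
  by rewrite mulNr [N%:R - a]addrC E -natr1; ring.
(* The old boundary term is rewritten through [A x N.+1], the coefficient of all newly added
   terms. *)
have e3 : (c - 1) * (N%:R - x) * A x N * pochhammer (- a) N =
    c * (A x N.+1 * ((b + N%:R) * N.+1%:R)) * pochhammer (- a) N.
  by rewrite AS -cz; ring.
have recr y : meixner_sum y x N.+2 =
    meixner_sum y x N.+1 + pochhammer (- y) N.+1 * A x N.+1.
  by rewrite /meixner_sum big_nat_recr.
rewrite !recr.
move: IH; rewrite e3 => /eqP; rewrite -subr_eq0 => /eqP IH.
apply/eqP; rewrite -subr_eq0 -{}IH; apply/eqP.
rewrite [pochhammer (- a) N.+1]pochhammerS e1.
move: e2; move: (pochhammer (- (a - 1)) N.+1) => q e2.
rewrite [a * (_ + q * _)]mulrDr [a * (q * _)]mulrA e2 -natr1.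
by ring.
Qed.

Definition meixner_F (n x : nat) : R := hyp2F1 (- n%:R) (- x%:R) b z.

(** The series terminates since [(-n)_j = 0] for [j > n]. Any cutoff beyond [n] is allowed, so that
    three consecutive degrees can share one. *)
Lemma meixner_F_sum n x N : (n < N)%N ->
  meixner_F n x = meixner_sum n%:R x%:R N.
Proof.
move=> nN; apply: cvg_lim; first exact: Rhausdorff.
apply: cvg_near_cst; near=> M.
rewrite /meixner_sum /series /= (big_cat_nat (n := N))//=; last first.
  by near: M; exact: nbhs_infty_ge.
rewrite [X in _ + X]big_nat [X in _ + X]big1 ?addr0 => [|j /andP[Nj _]].
  by apply: eq_bigr => j _; rewrite /A !mulrA.
by rewrite pochhammer_nat_eq0 ?(leq_trans nN)// !mul0r.
Unshelve. all: by end_near. Qed.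

Lemma meixner_F_sym n x : meixner_F n x = meixner_F x n.
Proof.
rewrite /meixner_F /hyp2F1; congr (limn (series _)); apply/funext => j.
by rewrite [pochhammer (- n%:R) j * _]mulrC.
Qed.

Lemma meixner_F0 x : meixner_F 0 x = 1.
Proof.
rewrite (@meixner_F_sum _ _ 1)// /meixner_sum big_nat1 /A !pochhammer0 fact0.
by rewrite expr0; field.
Qed.

(** At the cutoff [n.+2] the boundary term of [meixner_sum_rec] vanishes. For [n = 0] the value of
    [n.-1] is immaterial, its coefficient being 0. *)
Lemma meixner_F_rec n x :
  c * (n%:R + b) * meixner_F n.+1 x - (n%:R + (n%:R + b) * c) * meixner_F n x
  + n%:R * meixner_F n.-1 x = (c - 1) * x%:R * meixner_F n x.
Proof.
have := meixner_sum_rec n%:R x%:R n.+2.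
rewrite pochhammer_nat_eq0// mulr0 => /eqP; rewrite subr_eq0 => /eqP.
have FE m : (m <= n.+1)%N -> meixner_F m x = meixner_sum m%:R x%:R n.+3.
  by move=> mn; apply: meixner_F_sum; rewrite ltnS (leq_trans mn).
rewrite !FE// ?(leq_trans (leq_pred _))// natr1.
by case: n {FE} => [|n]; rewrite ?mul0r// -natr1 addrK.
Qed.

(** Solved for the highest degree, the recurrence has coefficients at most linear in [x]; the
    induction carries two consecutive degrees. *)
Lemma subexp_meixner_F n : subexp (meixner_F n).
Proof.
suff : subexp (meixner_F n) /\ subexp (meixner_F n.-1) by case.
elim: n => [|n [IHn IHp]] /=.
  rewrite (_ : meixner_F 0 = fun=> 1); last exact/funext/meixner_F0.
  by split; exact: subexp_cst.
split=> //.
have nb : c * (n%:R + b) != 0 by rewrite mulf_neq0 ?gt_eqF// ltr_wpDl.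
have -> : meixner_F n.+1 = fun x => (c * (n%:R + b))^-1 *
    (((c - 1) * x%:R + (n%:R + (n%:R + b) * c)) * meixner_F n x
     + (- n%:R) * meixner_F n.-1 x).
  apply/funext => x; apply: (mulfI nb); rewrite mulVKf// [in RHS]mulrDl.
  by rewrite -meixner_F_rec; ring.
apply: subexpM; first exact: subexp_cst.
apply: subexpD; apply: subexpM => //; last exact: subexp_cst.
apply: subexpD; last exact: subexp_cst.
by apply: subexpM; [exact: subexp_cst|exact: subexp_nat].
Qed.

Let a (x : nat) : R := pochhammer b x / (x`!)%:R.
Let w (x : nat) : R := a x * c ^+ x.

Let aS n : n.+1%:R * a n.+1 = (b + n%:R) * a n.
Proof. exact: pochhammer_fact_rec. Qed.

Let a_gt0 n : 0 < a n.
Proof. by rewrite divr_gt0 ?pochhammer_gt0// ltr0n fact_gt0. Qed.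

Let w_gt0 n : 0 < w n. Proof. by rewrite mulr_gt0// exprn_gt0. Qed.

Let wS n : n.+1%:R * w n.+1 = c * (b + n%:R) * w n.
Proof. by rewrite /w exprS mulrA aS; ring. Qed.

Let subexp_a : subexp a. Proof. exact: subexp_pochhammer. Qed.

Let normc1 : `|c| < 1. Proof. by rewrite gtr0_norm. Qed.

(** Summation against the unnormalized weight [w], written as a power series in [c] so that
    subexponential growth gives convergence. *)
Let ip (f : nat -> R) := limn (pseries (fun x => a x * f x) c).

Let ip_cvg f : subexp f -> series (fun x => w x * f x) @ \oo --> ip f.
Proof.
move=> sf; have -> : (fun x => w x * f x) = (fun x => a x * f x * c ^+ x).
  by apply/funext => x; rewrite /w; ring.
exact: (subexp_is_cvg (subexpM subexp_a sf) normc1).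
Qed.

Let ipZD k f g : subexp f -> subexp g ->
  ip (fun x => k * f x + g x) = k * ip f + ip g.
Proof.
move=> sf sg.
have sfg := subexpD (subexpM (subexp_cst k) sf) sg.
apply: (cvg_unique (@Rhausdorff R) (ip_cvg sfg)).
have -> : series (fun x => w x * (k * f x + g x)) =
   (fun N => k * series (fun x => w x * f x) N + series (fun x => w x * g x) N).
  apply/funext => N; rewrite /series /= mulr_sumr -big_split /=.
  by apply: eq_bigr => x _; ring.
apply: cvgD; last exact: ip_cvg.
by apply: cvgMl_tmp; exact: ip_cvg.
Qed.

Let S n m := ip (fun x => meixner_F n x * meixner_F m x).

Let sF2 n m : subexp (fun x => meixner_F n x * meixner_F m x).
Proof. by apply: subexpM; exact: subexp_meixner_F. Qed.

Let S_sym n m : S n m = S m n.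
Proof. by congr ip; apply/funext => x; rewrite mulrC. Qed.

(** [meixner_F_rec] summed against [meixner_F m]; the point is that the right-hand side is symmetric
    in [n] and [m]. *)
Let S_rec n m : c * (n%:R + b) * S n.+1 m - (n%:R + (n%:R + b) * c) * S n m
    + n%:R * S n.-1 m =
  ip (fun x => (c - 1) * x%:R * (meixner_F n x * meixner_F m x)).
Proof.
have sZ (k : R) (f : nat -> R) : subexp f -> subexp (fun x => k * f x).
  by move=> sf; apply: subexpM => //; exact: (subexp_cst k).
have s0 : subexp (fun=> 0 : R) by exact: subexp_cst.
have ip0 : ip (fun=> 0) = 0.
  have E := ipZD (-1) s0 s0; rewrite (mulN1r (ip _)) addNr in E.
  rewrite -[RHS]E.
  by congr ip; apply/funext => x; rewrite mulr0 addr0.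
have s1 := subexpD (sZ (n%:R : R) _ (sF2 n.-1 m)) s0.
have s2 := subexpD (sZ (- (n%:R + (n%:R + b) * c)) _ (sF2 n m)) s1.
rewrite -mulNr -addrA -[n%:R * _]addr0 -ip0.
rewrite -(ipZD _ (sF2 n.-1 m) s0) -(ipZD _ (sF2 n m) s1).
rewrite -(ipZD _ (sF2 n.+1 m) s2).
congr ip; apply/funext => x; rewrite [RHS]mulrA -meixner_F_rec; ring.
Qed.

(* By the recurrence in [x], the partial sums of [w x * meixner_F m x]
   telescope. *)
Let S0_eq0 m : (0 < m)%N -> S 0 m = 0.
Proof.
move=> m0.
have cm : (c - 1) * m%:R != 0.
  apply: mulf_neq0; first by rewrite subr_eq0 lt_eqF.
  by rewrite pnatr_eq0 -lt0n.
apply: (mulfI cm); rewrite mulr0.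
(* [meixner_F_sym] turns the recurrence in the degree into one in the variable. At [N = 0] the
   prefactor kills the term with [N.-1]. *)
have tele N : (c - 1) * m%:R * series (fun x => w x * meixner_F m x) N =
    N%:R * w N * (meixner_F m N - meixner_F m N.-1).
  elim: N => [|N IH]; first by rewrite /series /= big_geq// mulr0 !mul0r.
  rewrite /series /= big_nat_recr//= mulrDr [X in X + _]IH wS.
  have := meixner_F_rec N m; rewrite !(meixner_F_sym _ m) => E.
  have -> : (c - 1) * m%:R * (w N * meixner_F m N) =
      w N * ((c - 1) * m%:R * meixner_F m N) by ring.
  rewrite -E; ring.
have cvgS :
    (c - 1) * m%:R * series (fun x => w x * meixner_F m x) N @[N --> \oo] -->
    (c - 1) * m%:R * S 0 m.
  apply: cvgMl_tmp; rewrite /S.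
  under [X in ip X]eq_fun do rewrite meixner_F0 mul1r.
  exact/ip_cvg/subexp_meixner_F.
suff : (c - 1) * m%:R * series (fun x => w x * meixner_F m x) N @[N --> \oo]
    --> 0 by exact: (cvg_unique (@Rhausdorff R) cvgS).
rewrite (eq_cvg _ _ tele).
(* The shift removes the predecessor; the boundary term then splits into two subexponential
   sequences times powers of [c]. *)
rewrite -cvg_shiftS /=.
have -> : (fun n => n.+1%:R * w n.+1 * (meixner_F m n.+1 - meixner_F m n)) =
  (fun n => n.+1%:R * a n.+1 * meixner_F m n.+1 * c ^+ n.+1
   - (c * (b + n%:R) * a n * meixner_F m n) * c ^+ n).
  apply/funext => n; rewrite mulrBr; congr (_ - _); first by rewrite /w; ring.
  by rewrite wS /w; ring.
have l1 : n.+1%:R * a n.+1 * meixner_F m n.+1 * c ^+ n.+1 @[n --> \oo] --> 0.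
  rewrite (cvg_shiftS (fun n => n%:R * a n * meixner_F m n * c ^+ n)).
  apply: subexp_cvg0 => //; apply: subexpM; last exact: subexp_meixner_F.
  by apply: subexpM => //; exact: subexp_nat.
have l2 : c * (b + n%:R) * a n * meixner_F m n * c ^+ n @[n --> \oo] --> 0.
  apply: subexp_cvg0 => //; apply: subexpM; last exact: subexp_meixner_F.
  apply: subexpM => //; apply: subexpM; first exact: subexp_cst.
  by apply: subexpD; [exact: subexp_cst|exact: subexp_nat].
by have := cvgB l1 l2; rewrite subr0; exact.
Qed.

Let S00 : S 0 0 * (1 - c) `^ b = 1.
Proof.
rewrite -[RHS](binomial_series b0 c01) /S /ip; congr (limn (pseries _ _) * _).
by apply/funext => x; rewrite meixner_F0 !mulr1.
Qed.

(* By [S_rec] the Jacobi operator acts in the same way on both indices of [S],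
   so [S] is determined by its row [S 0 m]. *)
Let S_orth n m : S n m = (n == m)%:R * (S 0 0 / w n).
Proof.
elim/ltn_ind: n m => -[_ [|m]|k IH m].
- by rewrite mul1r /w /a pochhammer0 fact0 expr0 divr1 mulr1 divr1.
- by rewrite S0_eq0// mul0r.
have IHk m' : S k m' = (k == m')%:R * (S 0 0 / w k) by exact: IH.
(* The factors [k] here and [m] in [IHm] are kept so that the predecessor of 0 does no harm. *)
have IHp : k%:R * S k.-1 m = k%:R * ((k == m.+1)%:R * (S 0 0 / w m)).
  case: k IH {IHk} => [|k] IH; first by rewrite !mul0r.
  by rewrite IH// eqSS; case: eqP => [->//|_]; rewrite !mul0r.
have IHm : m%:R * S k m.-1 = m%:R * ((m == k.+1)%:R * (S 0 0 / w k)).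
  by case: m {IHp} => [|m]; rewrite ?mul0r// IHk eqSS eq_sym.
have nb : c * (k%:R + b) != 0 by rewrite mulf_neq0 ?gt_eqF// ltr_wpDl.
apply: (mulfI nb).
have := S_rec k m; have := S_rec m k.
have -> : (fun x => (c - 1) * x%:R * (meixner_F m x * meixner_F k x)) =
  (fun x => (c - 1) * x%:R * (meixner_F k x * meixner_F m x)).
  by apply/funext => x; rewrite [meixner_F m x * _]mulrC.
move=> <-; rewrite ![S _ k]S_sym IHm IHp !IHk.
have wn0 i : w i != 0 by exact: lt0r_neq0.
rewrite [k.+1 == m]eq_sym.
(* The recurrence of the weight matches the raising coefficient with the lowering one. In the cases
   below only [m = k.+1] has a nonzero target. *)
have TE i : c * (i%:R + b) * (S 0 0 / w i.+1) = i.+1%:R * (S 0 0 / w i).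
  rewrite !mulrA; apply/eqP; rewrite eqr_div// mulrAC [X in _ == X]mulrAC.
  by rewrite wS; apply/eqP; ring.
have F0 : false%:R = 0 :> R by [].
have T1 : true%:R = 1 :> R by [].
have [km|km] := eqVneq k m.
  rewrite -km [k == k.+1]ltn_eqF// T1 F0 !mul0r !mulr0 !addr0 add0r.
  by rewrite -[X in _ = X]add0r => /addIr.
have [kSm|kSm] := eqVneq m k.+1.
  rewrite kSm [k == k.+2](ltn_eqF (leqnSn k.+1)) T1 F0 !mul0r !mulr0 !mul1r.
  by rewrite !subr0 !addr0 add0r -TE.
have [mSk|mSk] := eqVneq k m.+1.
  rewrite mSk T1 F0 !mul0r !mulr0 !mul1r !subr0 addr0 TE.
  by rewrite -[X in _ = X]add0r => /addIr.
by rewrite F0 !(mul0r, mulr0) !subr0 !addr0.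
Qed.

Let meixnerE n x : meixner n x%:R b c =
  (-1) ^+ n * Num.sqrt (w n) * meixner_F n x.
Proof. by []. Qed.

Let sqr_sqrt_w n : Num.sqrt (w n) * Num.sqrt (w n) = w n.
Proof. by rewrite -expr2 sqr_sqrtr// ltW. Qed.

Lemma meixner_orthonormal n m :
  series (fun x => meixner n x%:R b c * meixner m x%:R b c *
    (pochhammer b x / (x`!)%:R * c ^+ x * (1 - c) `^ b)) @ \oo -->
  ((n == m)%:R : R).
Proof.
pose K := (-1) ^+ n * Num.sqrt (w n) * ((-1) ^+ m * Num.sqrt (w m))
  * (1 - c) `^ b.
have -> : (fun x => meixner n x%:R b c * meixner m x%:R b c *
    (pochhammer b x / (x`!)%:R * c ^+ x * (1 - c) `^ b)) =
    (fun x => K * (w x * (meixner_F n x * meixner_F m x))).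
  by apply/funext => x; rewrite !meixnerE /K /w /a; ring.
have -> : series (fun x => K * (w x * (meixner_F n x * meixner_F m x))) =
    (fun N => K * series (fun x => w x * (meixner_F n x * meixner_F m x)) N).
  by apply/funext => N; rewrite /series /= mulr_sumr.
have -> : ((n == m)%:R : R) = K * S n m.
  rewrite S_orth /K; have [<-|_] := eqVneq n m; last by rewrite mul0r mulr0.
  have wn0 : w n != 0 by exact: lt0r_neq0.
  rewrite [X in X * _ * _]mulrACA -expr2 sqrr_sign sqr_sqrt_w !mul1r.
  by rewrite mulrCA [w n * _ / _]mulrAC mulfV// mul1r S00.
by apply: cvgMl_tmp; exact: ip_cvg.
Qed.

(** In a sum over the degree the signs cancel and the squared normalizations supply the weight
    [w n]; by symmetry of [meixner_F] the sum is [S x y]. *)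
Lemma meixner_dual_orthonormal x y :
  series (fun n => meixner n x%:R b c * meixner n y%:R b c) @ \oo -->
  (x == y)%:R / (pochhammer b x / (x`!)%:R * c ^+ x * (1 - c) `^ b).
Proof.
have -> : (fun n => meixner n x%:R b c * meixner n y%:R b c) =
    (fun n => w n * (meixner_F x n * meixner_F y n)).
  apply/funext => n; rewrite !meixnerE mulrACA [X in X * _ = _]mulrACA -expr2.
  by rewrite sqrr_sign sqr_sqrt_w mul1r !(meixner_F_sym n).
have -> : (x == y)%:R / (pochhammer b x / (x`!)%:R * c ^+ x * (1 - c) `^ b) =
    S x y.
  have p0 : (1 - c) `^ b != 0 by rewrite powR_eq0 subr_eq0 gt_eqF.
  rewrite S_orth; congr (_ * _); rewrite -/(a x) -/(w x).
  have wn0 : w x != 0 by exact: lt0r_neq0.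
  apply: (mulfI p0); rewrite [RHS]mulrA [_ * S 0 0]mulrC S00.
  by field; rewrite wn0.
exact: ip_cvg.
Qed.

(** The recurrence in symmetric form: normalization by [Num.sqrt (w n)] turns the off-diagonal
    coefficients into square roots, the sign [(-1) ^ n] makes them positive, and adding
    [(1 - c) * (b / 2)] to both sides makes the diagonal [(1 + c) * (n + b / 2)]. *)
Lemma meixner_jacobi n x :
  Num.sqrt c * (Num.sqrt ((n%:R + 1) * (b + n%:R)) * meixner n.+1 x%:R b c +
    Num.sqrt (n%:R * (b + n%:R - 1)) * meixner n.-1 x%:R b c)
  + (1 + c) * (n%:R + b / 2) * meixner n x%:R b c =
  (1 - c) * (x%:R + b / 2) * meixner n x%:R b c.
Proof.
rewrite !meixnerE.
have up :
    Num.sqrt c * (Num.sqrt ((n%:R + 1) * (b + n%:R)) * Num.sqrt (w n.+1)) =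
    c * (n%:R + b) * Num.sqrt (w n).
  rewrite -!sqrtrM ?mulr_ge0 ?addr_ge0 ?(ltW b0) ?(ltW c0)//.
  have -> : c * ((n%:R + 1) * (b + n%:R) * w n.+1) =
      (c * (n%:R + b)) ^+ 2 * w n.
    have := wS n; rewrite -natr1 => E.
    have -> : c * ((n%:R + 1) * (b + n%:R) * w n.+1) =
       c * (b + n%:R) * ((n%:R + 1) * w n.+1) by ring.
    by rewrite E; ring.
  rewrite sqrtrM ?sqr_ge0// sqrtr_sqr ger0_norm//.
  by rewrite mulr_ge0 ?addr_ge0 ?(ltW b0) ?(ltW c0).
have dn : Num.sqrt c * (Num.sqrt (n%:R * (b + n%:R - 1)) * Num.sqrt (w n.-1)) =
    n%:R * Num.sqrt (w n).
  case: n {up} => [|n]; first by rewrite !mul0r sqrtr0 mul0r mulr0.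
  have -> : b + n.+1%:R - 1 = b + n%:R by rewrite -natr1; ring.
  rewrite -!sqrtrM ?mulr_ge0 ?addr_ge0 ?(ltW b0) ?(ltW c0)//=.
  have -> : c * (n.+1%:R * (b + n%:R) * w n) = n.+1%:R ^+ 2 * w n.+1.
    have -> : c * (n.+1%:R * (b + n%:R) * w n) =
      n.+1%:R * (c * (b + n%:R) * w n) by ring.
    by rewrite -wS; ring.
  by rewrite sqrtrM ?sqr_ge0// sqrtr_sqr ger0_norm.
have dn' : n%:R * ((-1) ^+ n.-1 : R) = - (n%:R * (-1) ^+ n).
  by case: n {up dn} => [|n]; rewrite ?mul0r ?oppr0//= exprS; ring.
set p := Num.sqrt (_ * (b + n%:R)) in up *.
set q := Num.sqrt (_ * (b + n%:R - 1)) in dn *.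
have -> : Num.sqrt c *
    (p * ((-1) ^+ n.+1 * Num.sqrt (w n.+1) * meixner_F n.+1 x)
    + q * ((-1) ^+ n.-1 * Num.sqrt (w n.-1) * meixner_F n.-1 x)) =
  - (-1) ^+ n * meixner_F n.+1 x * (Num.sqrt c * (p * Num.sqrt (w n.+1)))
  + (-1) ^+ n.-1 * meixner_F n.-1 x * (Num.sqrt c * (q * Num.sqrt (w n.-1))).
  by rewrite exprS; ring.
rewrite up dn.
have -> : (-1) ^+ n.-1 * meixner_F n.-1 x * (n%:R * Num.sqrt (w n)) =
    n%:R * (-1) ^+ n.-1 * meixner_F n.-1 x * Num.sqrt (w n) by ring.
rewrite dn'.
have -> : (1 - c) * (x%:R + b / 2) *
    ((-1) ^+ n * Num.sqrt (w n) * meixner_F n x) =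
  (-1) ^+ n * Num.sqrt (w n) * (- ((c - 1) * x%:R * meixner_F n x)
    + (1 - c) * (b / 2) * meixner_F n x) by ring.
by rewrite -meixner_F_rec; field.
Qed.

End Meixner.

(** * The Lax flow *)

Section HalfLineDerivative.
Context {R : realType}.
Implicit Types (f g : R -> R) (t : R).

Lemma deriv_nng_is_derive f g t : deriv_nng f g -> 0 < t ->
  is_derive t 1 f (g t).
Proof.
move=> fg t0; have /cvgrPdist_lt fgt := fg t (ltW t0).
have H : h^-1 *: (f (h *: 1 + t) - f t) @[h --> 0^'] --> g t.
  apply/cvgrPdist_lt => e /fgt; rewrite near_withinE.
  move=> /nbhs_ballP[d /= d0 dP].
  near=> h.
  have hn0 : h != 0 by near: h; exact: nbhs_dnbhs_neq.
  have := dP (h *: 1 + t).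
  rewrite /ball /= [h *: 1]mulr1 addrK opprD addrCA subrr addr0 normrN.
  rewrite mulrC; apply.
    by near: h; exact: dnbhs0_lt.
  split; last by rewrite -subr_eq0 addrK.
  (* Small increments keep [t + h] in the half-line, so the restriction in [deriv_nng]
     disappears. *)
  have : `|h| < t by near: h; exact: dnbhs0_lt.
  by rewrite ltr_norml => /andP[]; lra.
apply: DeriveDef; first by apply/cvg_ex; exists (g t).
exact: cvg_lim H.
Unshelve. all: by end_near. Qed.

Lemma deriv_nng_continuous f g t : deriv_nng f g -> 0 < t ->
  {within `[0, t], continuous f}.
Proof.
move=> fg t0.
have df x : 0 < x -> {for x, continuous f}.
  move=> x0; have [dx _] := deriv_nng_is_derive fg x0.
  by apply: differentiable_continuous; exact/derivable1_diffP.
apply/(continuous_within_itvP _ t0); split.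
- by move=> x; rewrite in_itv /= => /andP[x0 _]; exact: df.
(* At 0 continuity from the right is recovered by multiplying the difference quotient by [x - 0]. *)
- have f0 := fg 0 (lexx 0).
  have q0 : (f x - f 0) / (x - 0) @[x --> 0^'+] --> g 0.
    apply: cvg_trans f0; apply: cvg_app; apply: within_subset => x /= x0.
    by rewrite ltW ?gt_eqF.
  have x0 : (fun x : R => x - 0) x @[x --> 0^'+] --> 0 - 0.
    by apply: cvgB; [exact: cvg_at_right_filter|exact: cvg_cst].
  have : (f x - f 0) / (x - 0) * (x - 0) + f 0 @[x --> 0^'+] -->
      g 0 * (0 - 0) + f 0.
    by apply: cvgD; [exact: cvgM|exact: cvg_cst].
  rewrite [X in g 0 * X]subrr mulr0 add0r => fc; apply: cvg_trans fc.
  apply: near_eq_cvg; near=> x; rewrite divfK ?subrK//.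
  by rewrite subr0 gt_eqF//; near: x; exact: nbhs_right_gt.
- by apply: cvg_at_left_filter; exact: df.
Unshelve. all: by end_near. Qed.

End HalfLineDerivative.

(** * Positivity and the conserved quantity *)

Section LaxFlow.
Context {R : realType}.

Lemma continuous_nonvanishing_gt0 (f : R -> R) (t : R) : 0 <= t ->
  {within `[0, t], continuous f} -> 0 < f 0 ->
  (forall x, 0 <= x -> f x != 0) -> 0 < f t.
Proof.
move=> t0 cf f0 fn0; rewrite ltNge; apply/negP => ft.
have [|x] := IVT t0 cf (v := 0).
  by rewrite ge_min ft orbT le_max ltW.
by rewrite in_itv /= => /andP[x0 _] /eqP; apply/negP/fn0.
Qed.

Variables r s u : R -> R.
Hypotheses (s_ode : deriv_nng s (fun t => - 2 * u t * r t))
  (r_ode : deriv_nng r (fun t => - 2 * u t * s t))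
  (sgn_ur : forall t : R, 0 < t -> Num.sg (u t) = - Num.sg (r t))
  (s0_gt0 : 0 < s 0) (r0_gt0 : 0 < r 0)
  (rs_gt0 : forall t : R, 0 <= t -> 0 < s t ^+ 2 - r t ^+ 2).

Let continuous_sqr (f : R -> R) t : {within `[0, t], continuous f} ->
  {within `[0, t], continuous (fun x => f x ^+ 2)}.
Proof. by move=> cf x; apply: cvgM; exact: cf. Qed.

Lemma lax_s_gt0 t : 0 <= t -> 0 < s t.
Proof.
rewrite le_eqVlt => /predU1P[<-//|t0].
apply: (continuous_nonvanishing_gt0 (ltW t0)) => //.
  exact: deriv_nng_continuous s_ode t0.
move=> x x0; apply: contraTneq (rs_gt0 x0) => ->.
by rewrite expr0n sub0r oppr_gt0 -leNgt sqr_ge0.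
Qed.

(** The derivative is [2 s s' - 2 r r' = -4 u r s + 4 u r s = 0]. *)
Lemma lax_conserved t : 0 <= t -> s t ^+ 2 - r t ^+ 2 = s 0 ^+ 2 - r 0 ^+ 2.
Proof.
rewrite le_eqVlt => /predU1P[<-//|t0].
have cs := continuous_sqr (deriv_nng_continuous s_ode t0).
have cr := continuous_sqr (deriv_nng_continuous r_ode t0).
have [|||x _] := @MVT R (fun x => s x ^+ 2 - r x ^+ 2) (fun=> 0) 0 t.
- exact: t0.
- move=> x; rewrite in_itv /= => /andP[x0 _].
  have ds := deriv_nng_is_derive s_ode x0.
  have dr := deriv_nng_is_derive r_ode x0.
  apply: (is_derive_eq (is_deriveB (is_deriveX 2 ds) (is_deriveX 2 dr))).
  by rewrite /GRing.scale /=; ring.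
- by move=> x; apply: cvgB; [exact: cs|exact: cr].
by rewrite mul0r => /eqP; rewrite subr_eq0 => /eqP.
Qed.

(* The sign condition makes [u r <= 0], so [r^2] is nondecreasing. *)
Lemma lax_r_gt0 t : 0 <= t -> 0 < r t.
Proof.
rewrite le_eqVlt => /predU1P[<-//|t0].
apply: (continuous_nonvanishing_gt0 (ltW t0)) => //.
  exact: deriv_nng_continuous r_ode t0.
move=> y; rewrite le_eqVlt => /predU1P[<-|y0]; first by rewrite gt_eqF.
have cr := continuous_sqr (deriv_nng_continuous r_ode y0).
have ur x : 0 < x -> u x * r x <= 0.
  move=> x0; rewrite -sgr_le0 sgrM sgn_ur// mulNr oppr_le0 -expr2.
  exact: sqr_ge0.
have [|||x] := @MVT R (fun x => r x ^+ 2)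
  (fun x => - 4 * (u x * r x) * s x) 0 y.
- exact: y0.
- move=> x; rewrite in_itv /= => /andP[x0 _].
  apply: (is_derive_eq (is_deriveX 2 (deriv_nng_is_derive r_ode x0))).
  by rewrite /GRing.scale /=; ring.
- exact: cr.
rewrite in_itv /= => /andP[x0 _] E.
rewrite -sqrf_eq0 gt_eqF// (lt_le_trans (exprn_gt0 2 r0_gt0))//.
rewrite -subr_ge0 E subr0 mulr_ge0 ?(ltW y0)//.
rewrite mulr_ge0 ?(ltW (lax_s_gt0 (ltW x0)))//.
by rewrite mulNr oppr_ge0 pmulr_rle0// ur.
Qed.

End LaxFlow.

(** * The two descriptions of the parameter [c] *)

Section Arccosh.
Context {R : realType}.

(** The exponential of [arccosh y] is [y + d], whose inverse is [y - d]. Hence [c = (y - d) ^ 2] and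
    [Num.sqrt c = y - d]; conversely [y + d] is the inverse of [Num.sqrt c]. *)
Lemma arccosh_expR (y c : R) : 1 < y ->
  (0 < c < 1 /\ y = (1 + c) / (2 * Num.sqrt c)) <->
  c = expR (- 2 * arccosh y).
Proof.
move=> y1; have y0 := lt_trans ltr01 y1.
set d := Num.sqrt (y ^+ 2 - 1).
have d2 : d ^+ 2 = y ^+ 2 - 1.
  by rewrite sqr_sqrtr// subr_ge0 expr_ge1// ltW.
have d_ge0 : 0 <= d by exact: sqrtr_ge0.
have yd0 : 0 < y + d by rewrite ltr_wpDr.
have -> : expR (- 2 * arccosh y) = (y + d) ^- 2.
  rewrite /arccosh -/d mulNr expRN; congr (_^-1).
  by rewrite expRM_natl lnK// posrE.
split=> [[/andP[c0 c1] yE]|->].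
  set q := Num.sqrt c in yE.
  have q0 : 0 < q by rewrite sqrtr_gt0.
  have cE : c = q ^+ 2 by rewrite sqr_sqrtr// ltW.
  have dE : d = (1 - c) / (2 * q).
    rewrite /d; have -> : y ^+ 2 - 1 = ((1 - c) / (2 * q)) ^+ 2.
      by rewrite yE cE; field; rewrite gt_eqF.
    rewrite sqrtr_sqr ger0_norm// divr_ge0// ?subr_ge0 ?ltW//.
    by rewrite mulr_gt0.
  have -> : y + d = q^-1 by rewrite dE yE; field; rewrite gt_eqF.
  by rewrite exprVn invrK.
have inv : (y + d)^-1 = y - d.
  apply: (mulfI (lt0r_neq0 yd0)); rewrite mulfV ?gt_eqF//.
  by rewrite mulrC -subr_sqr d2 subKr.
have sq : Num.sqrt ((y + d) ^- 2) = y - d.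
  by rewrite -exprVn sqrtr_sqr inv ger0_norm// -inv invr_ge0 ltW.
split.
  rewrite invr_gt0 exprn_gt0//= invf_lt1 ?exprn_gt0// exprn_egt1//.
  by rewrite ltr_wpDr.
have ydn0 : y - d != 0 by rewrite -inv invr_eq0 gt_eqF.
rewrite sq -exprVn inv sqrrB d2; field.
by rewrite ydn0.
Qed.

End Arccosh.

(** * The Meixner transform *)

Section RealInner.
Context {R : realType}.
Variable W : nat -> R.
Hypothesis W_gt0 : forall x, 0 < W x.

Lemma l2_pred_real (a : nat -> R) :
  cvgn (series (fun x => a x * a x * W x)) ->
  (fun x => (a x)%:C) \in l2_pred W.
Proof.
move=> ca; apply/(l2_predP W_gt0).
rewrite [X in series X](_ : _ = (fun x => a x * a x * W x))//.
by apply/funext => x; rewrite /= expr0n addr0 sqrtr_sqr real_normK ?num_real.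
Qed.

Lemma inner_real (a b : nat -> R) (f g : l2 W) (l : R) :
  (forall x, f x = (a x)%:C) -> (forall x, g x = (b x)%:C) ->
  series (fun x => a x * b x * W x) @ \oo --> l -> inner f g = l%:C.
Proof.
move=> fa gb abl; apply: inner_lim.
have -> : series (fun x => f x * (g x)^*%R * (W x)%:C) =
    (fun n => (series (fun x => a x * b x * W x) n)%:C).
  apply/funext => n; rewrite /series /= rmorph_sum; apply: eq_bigr => x _.
  by rewrite fa gb conj_real_complex !rmorphM.
exact: cvg_real_complex.
Qed.

End RealInner.

Section MeixnerTransform.
Context {R : realType}.
Variables k c : R.
Hypotheses (k_gt0 : 0 < k) (c01 : 0 < c < 1).
Local Notation W := (meixner_weight k c).
Local Notation l2N := (l2 (fun=> 1 : R)).

Let b_gt0 : 0 < 2 * k. Proof. by rewrite mulr_gt0. Qed.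

Lemma meixner_weight_gt0 x : 0 < W x.
Proof.
have /andP[c0 c1] := c01.
rewrite !mulr_gt0 ?exprn_gt0 ?invr_gt0 ?ltr0n ?fact_gt0 ?pochhammer_gt0//.
by apply: powR_gt0; rewrite subr_gt0.
Qed.

Fact meixner_psi_subproof x :
  (fun n => (meixner n x%:R (2 * k) c)%:C) \in l2_pred (fun=> 1 : R).
Proof.
apply: l2_pred_real => //; apply/cvg_ex.
exists ((x == x)%:R / W x); under eq_fun do rewrite mulr1.
exact: meixner_dual_orthonormal.
Qed.

(** The Meixner polynomials at a fixed point as a sequence in the degree: a column of the matrix of
    [U]. *)
Definition meixner_psi x : l2N := L2 (meixner_psi_subproof x).

Lemma meixner_psi_orth x y :
  inner (meixner_psi x) (meixner_psi y) = (x == y)%:R * ((W x)^-1)%:C.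
Proof.
rewrite -[(x == y)%:R](rmorph_nat (real_complex R)) -rmorphM.
apply: (inner_real (a := fun n => meixner n x%:R (2 * k) c)
  (b := fun n => meixner n y%:R (2 * k) c)) => //.
under eq_fun do rewrite mulr1.
exact: meixner_dual_orthonormal.
Qed.

(** The transform sends [f] to its coefficients against the columns [meixner_psi x], whose squared
    norms are the inverse weights. *)
Lemma meixner_op_exists : exists U : {linear l2N -> l2 W}, is_meixner_op U.
Proof.
exists (l2coef weight1_gt0 meixner_weight_gt0 meixner_psi_orth); split.
  by exists 1 => f; rewrite mul1r; exact: l2norm_coef.
move=> n x /=; rewrite innerC// inner_basis.
exact: conj_real_complex.
Qed.

Lemma meixner_op_unitary (U : {linear l2N -> l2 W}) : is_meixner_op U ->
  exists V : l2 W -> l2N, unitary_op U V.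
Proof.
move=> [Ub Ue].
apply: (unitary_of_basis meixner_weight_gt0 (psi := meixner_psi)) => //.
- move=> i j; rewrite -[RHS](rmorph_nat (real_complex R)).
  apply: (inner_real (Ue i) (Ue j)).
  exact: meixner_orthonormal.
- by move=> x n; rewrite Ue conj_real_complex.
- exact: meixner_psi_orth.
Qed.

End MeixnerTransform.

(** * Diagonalization of the Lax operator *)

Section Diagonalization.
Context {R : realType}.
Local Notation l2N := (l2 (fun=> 1 : R)).

Lemma domD_bounded (f : l2N) : domD f ->
  exists N, forall n, (N <= n)%N -> f n = 0.
Proof.
move=> /finite_seqP[r fr]; exists (\max_(i <- r) i).+1 => n rn.
apply: contrapT => /eqP fn0.
have nr : n \in r by have : [set n | f n != 0] n by []; rewrite fr.
by have := leq_bigmax_seq (P := xpredT) (F := id) n nr isT; rewrite leqNgt rn.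
Qed.

Lemma pi_k_sum k (X : 'M[R[i]]_2) (f : l2N) N :
  (forall n, (N <= n)%N -> f n = 0) ->
  pi_k k X f = \sum_(0 <= n < N)
    f n *: (X 0 0 *: piH k n + X 0 1 *: Defs.piE k n + X 1 0 *: piF k n).
Proof.
move=> fN; rewrite /pi_k (@fsbigE _ _ _ _ _ (index_iota 0 N)) ?iota_uniq//;
  last first.
  move=> n _; rewrite mem_index_iota /= -leqNgt => /fN ->.
  exact: scale0r.
by apply: eq_bigl => n; rewrite in_setT.
Qed.

Lemma domD_sum (f : l2N) N : (forall n, (N <= n)%N -> f n = 0) ->
  f = \sum_(0 <= n < N) f n *: basis_e n.
Proof.
move=> fN; rewrite [RHS](_ : _ = l2_trunc weight1_gt0 f N); last first.
  by apply: eq_bigr => n _; rewrite l2e_basis.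
by apply: l2_ext => x; rewrite l2_truncE; case: ltnP => // /fN.
Qed.

Variables (k c s r : R).
Hypotheses (k_gt0 : 0 < k) (c01 : 0 < c < 1) (r_gt0 : 0 < r)
  (src : s / r = (1 + c) / (2 * Num.sqrt c)).

Let c0 : 0 < c. Proof. by case/andP: c01. Qed.

Let sqrt_c_gt0 : 0 < Num.sqrt c. Proof. by rewrite sqrtr_gt0. Qed.

Let sE : s = r * (1 + c) / (2 * Num.sqrt c).
Proof. by rewrite -mulrA -src mulrC divfK// gt_eqF. Qed.

(** This rests on [(1 + c) ^ 2 - 4 * c = (1 - c) ^ 2]. *)
Lemma lax_gap : 2 * Num.sqrt (s ^+ 2 - r ^+ 2) = r * (1 - c) / Num.sqrt c.
Proof.
have qn0 : Num.sqrt c != 0 by rewrite gt_eqF.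
have cE : c = Num.sqrt c ^+ 2 by rewrite sqr_sqrtr// ltW.
have -> : s ^+ 2 - r ^+ 2 = (r * (1 - c) / (2 * Num.sqrt c)) ^+ 2.
  rewrite sE; move: cE qn0; set q := Num.sqrt c => cE qn0; rewrite cE.
  by field.
rewrite sqrtr_sqr ger0_norm; first by field.
have /andP[_ c1] := c01.
by rewrite divr_ge0 ?mulr_ge0 ?subr_ge0 ?ltW.
Qed.

(** This is [meixner_jacobi] at [b = 2 * k], scaled by [r / Num.sqrt c]. *)
Lemma lax_meixner n x :
  s * (2 * (k + n%:R)) * meixner n x%:R (2 * k) c
  + r * Num.sqrt ((n%:R + 1) * (2 * k + n%:R)) * meixner n.+1 x%:R (2 * k) c
  + r * Num.sqrt (n%:R * (2 * k + n%:R - 1)) * meixner n.-1 x%:R (2 * k) c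
  = 2 * Num.sqrt (s ^+ 2 - r ^+ 2) * (x%:R + k) * meixner n x%:R (2 * k) c.
Proof.
have k20 : 0 < 2 * k by rewrite mulr_gt0.
have qn0 : Num.sqrt c != 0 by rewrite gt_eqF.
have k2 : 2 * k / 2 = k by rewrite mulrC mulKf.
have := meixner_jacobi k20 c01 n x; rewrite k2 lax_gap sE.
move: (meixner n x%:R _ _) (meixner n.+1 _ _ _) (meixner n.-1 _ _ _).
move: (Num.sqrt (_ * (_ + _))) (Num.sqrt (_ * (_ - 1))) => p q m mS mp J.
apply: (mulfI qn0).
transitivity (r * ((1 - c) * (x%:R + k) * m)); last by field.
by rewrite -J; field.
Qed.

Lemma meixner_op_lax (U : {linear l2N -> l2 (meixner_weight k c)})
    (X : 'M[R[i]]_2) n x :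
  is_meixner_op U ->
  X 0 0 = s%:C -> X 0 1 = r%:C -> X 1 0 = - r%:C ->
  U (X 0 0 *: piH k n + X 0 1 *: Defs.piE k n + X 1 0 *: piF k n) x =
  (2 * Num.sqrt (s ^+ 2 - r ^+ 2) * (x%:R + k))%:C * U (basis_e n) x.
Proof.
move=> [_ Ue] -> -> ->.
have UZ a v : U (a *: v) x = a * U v x by rewrite linearZ.
have UH : U (piH k n) x = (2 * (k + n%:R) * meixner n x%:R (2 * k) c)%:C.
  by rewrite UZ Ue [in RHS]rmorphM.
have UE : U (Defs.piE k n) x = (Num.sqrt ((n%:R + 1) * (2 * k + n%:R)) *
    meixner n.+1 x%:R (2 * k) c)%:C.
  by rewrite UZ Ue [in RHS]rmorphM.
have UF : U (piF k n) x = - (Num.sqrt (n%:R * (2 * k + n%:R - 1)) *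
    meixner n.-1 x%:R (2 * k) c)%:C.
  (* At [n = 0] the vector in [piF] is 0, in agreement with the vanishing square root on the
     right. *)
  case: n {UH UE} => [|n]; rewrite UZ.
    by rewrite linear0 mulr0 mul0r sqrtr0 mul0r oppr0.
  by rewrite Ue mulNr [in RHS]rmorphM.
move: (piH k n) (Defs.piE k n) (piF k n) UH UE UF => vH vE vF UH UE UF.
rewrite 2!(raddfD U) !l2DE !UZ UH UE UF Ue mulrNN.
rewrite -!rmorphM -!rmorphD.
by rewrite -lax_meixner !mulrA.
Qed.

End Diagonalization.

Theorem theorem4p3 (R : realType) (r s u : R -> R) (k : R)
    (r_C1 : C1_nng r) (s_C1 : C1_nng s) (u_C0 : continuous_nng u)
    (s_ode : deriv_nng s (fun t => - 2 * u t * r t))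
    (r_ode : deriv_nng r (fun t => - 2 * u t * s t))
    (sgn_ur : forall t : R, 0 < t -> Num.sg (u t) = - Num.sg (r t))
    (s0_gt0 : 0 < s 0) (r0_gt0 : 0 < r 0)
    (rs_gt0 : forall t : R, 0 <= t -> 0 < s t ^+ 2 - r t ^+ 2)
    (k_gt0 : 0 < k) :
  (forall t : R, 0 <= t ->
     [/\ 0 < r t, 0 < s t & s t ^+ 2 - r t ^+ 2 = s 0 ^+ 2 - r 0 ^+ 2]) /\
  forall t : R, 0 < t ->
    (forall c : R,
       (0 < c < 1 /\ s t / r t = (1 + c) / (2 * Num.sqrt c)) <->
       c = expR (- 2 * arccosh (s t / r t))) /\
    forall c : R, 0 < c < 1 -> s t / r t = (1 + c) / (2 * Num.sqrt c) ->
      (exists U : {linear l2 (fun=> 1 : R) -> l2 (meixner_weight k c)},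
         is_meixner_op U) /\
      forall U : {linear l2 (fun=> 1 : R) -> l2 (meixner_weight k c)},
        is_meixner_op U ->
        exists Ustar : l2 (meixner_weight k c) -> l2 (fun=> 1 : R),
          unitary_op U Ustar /\
          forall g : l2 (meixner_weight k c), (U @` domD) g ->
            l2_fun (U (pi_k k (Lax s r t) (Ustar g))) =
            mulop (fun x : nat =>
                     (2 * Num.sqrt (s 0 ^+ 2 - r 0 ^+ 2) * (x%:R + k))%:C) g.

Proof.
split.
  move=> t t0; split.
  - exact: (lax_r_gt0 s_ode r_ode sgn_ur s0_gt0 r0_gt0 rs_gt0 t0).
  - exact: (lax_s_gt0 s_ode s0_gt0 rs_gt0 t0).
  - exact: (lax_conserved s_ode r_ode t0).
move=> t t_gt0; have t0 := ltW t_gt0.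
have rt := lax_r_gt0 s_ode r_ode sgn_ur s0_gt0 r0_gt0 rs_gt0 t0.
have st := lax_s_gt0 s_ode s0_gt0 rs_gt0 t0.
have sr1 : 1 < s t / r t.
  rewrite ltr_pdivlMr// mul1r -(@ltr_pXn2r _ 2)// ?nnegrE ?ltW//.
  by rewrite -subr_gt0 rs_gt0.
split; first by move=> c; exact: arccosh_expR.
move=> c c01 src; split; first exact: meixner_op_exists.
move=> U HU; have [V UV] := meixner_op_unitary k_gt0 c01 HU.
(* A vector of the domain is [U f] with [f] finitely supported, and [V] returns [f]. *)
exists V; split => // _ [f fD <-].
have [_ VK _] := UV; rewrite VK.
have [N fN] := domD_bounded fD.
apply/funext => x.
have UZ a v : U (a *: v) x = a * U v x by rewrite linearZ.
(* Conservation replaces the constant at time 0 by its value at time [t]; linearity then reduces the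
   identity to single basis vectors. *)
rewrite (pi_k_sum k (Lax s r t) fN) /mulop -(lax_conserved s_ode r_ode t0).
rewrite [in RHS](domD_sum fN) 2!(raddf_sum U) !l2_sumE mulr_sumr.
apply: eq_bigr => n _; rewrite !UZ mulrCA; congr (_ * _).
apply: meixner_op_lax => //; rewrite /Lax /sl2H /sl2E /sl2F !mxE /=.
- by rewrite !mulr0n; ring.
- by ring.
- by ring.
Qed.
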